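(* Let $n\geq 3$. There is a constant $C$, depending only on $n$, such that for all $u_0,u_1\in W^{n+1,1}(\mathbb{R}^n)$ the solution $u$ of the Cauchy problem $u_{tt}-u_{x_1x_1}=\Delta u_t$ on $\mathbb{R}^n\times(0,\infty)$, $u|_{t=0}=u_0$, $u_t|_{t=0}=u_1$, satisfies for all $t>0$ $$\|u(\cdot,t)\|_{L^{\infty}(\mathbb{R}^n)}\leq C t^{-\frac12}\,\|(u_0,u_1)\|_{W^{n+1,1}(\mathbb{R}^n)}.$$
   Context: $W^{m,p}(\mathbb{R}^n)$ is the usual Sobolev space, with norm equivalent to the $\ell^p$ sum of the $L^p$ norms of all derivatives of order at most $m$; $\|(u_0,u_1)\|_{W^{n+1,1}}=\|u_0\|_{W^{n+1,1}}+\|u_1\|_{W^{n+1,1}}$. $\hat f$ denotes the Fourier transform in $x\in\mathbb{R}^n$ (convention such that $\partial_{x_j}$ corresponds to multiplication by $\pm i\xi_j$); $\Delta=\sum_{j=1}^n\partial_{x_j}^2$; $\xi=(\xi_1,\dots,\xi_n)$. ''The solution $u$'' is the one given by the Green function: for $t>0$, $$\hat u(\xi,t)=(\partial_t+|\xi|^2)\hat G(\xi,t)\,\hat u_0(\xi)+\hat G(\xi,t)\,\hat u_1(\xi),$$ where, for each $\xi\in\mathbb{R}^n$, $\hat G(\xi,\cdot)$ is the solution of $\hat G_{tt}+|\xi|^2\hat G_t+\xi_1^2\hat G=0$, $\hat G(\xi,0)=0$, $\hat G_t(\xi,0)=1$. Explicitly, $\hat G(\xi,t)=\frac{e^{\lambda_+t}-e^{\lambda_-t}}{\lambda_0}$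 with $\lambda_\pm=\frac{-|\xi|^2\pm\sqrt{|\xi|^4-4\xi_1^2}}{2}$ and $\lambda_0=\sqrt{|\xi|^4-4\xi_1^2}$ (where $\lambda_0=0$ the quotient is understood as its limit $te^{-|\xi|^2t/2}$). *)

(* Defs.v *)
From HB Require Import structures.
From mathcomp Require Import all_boot all_order all_algebra.
From mathcomp Require Import all_classical all_reals all_analysis.
From mathcomp Require Import complex.

Set Implicit Arguments.
Unset Strict Implicit.
Unset Printing Implicit Defensive.

Import Order.TTheory GRing.Theory Num.Theory.
Import numFieldNormedType.Exports.

Local Open Scope classical_set_scope.
Local Open Scope ring_scope.
Local Open Scope complex_scope.

Definition rV_display : measure_display -> measure_display.
Proof. exact. Qed.

Section measurable_rV.
Context (R : realType) (n : nat).

Let coords (i : 'I_n) (x : 'rV[R]_n) : R := x ord0 i.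

Let rV_set0 : g_sigma_preimage coords set0.
Proof. exact: sigma_algebra0. Qed.

Let rV_setC A : g_sigma_preimage coords A -> g_sigma_preimage coords (~` A).
Proof. exact: sigma_algebraC. Qed.

Let rV_bigcup (F : (set 'rV[R]_n)^nat) :
  (forall i, g_sigma_preimage coords (F i)) ->
  g_sigma_preimage coords (\bigcup_i F i).
Proof. exact: sigma_algebra_bigcup. Qed.

HB.instance Definition _ := @isMeasurable.Build
  (rV_display default_measure_display) 'rV[R]_n
  (g_sigma_preimage coords) rV_set0 rV_setC rV_bigcup.

End measurable_rV.

Section lebesgue_rV.
Context (R : realType).

Definition cons_rV n (x : measurableTypeR R * 'rV[R]_n) : 'rV[R]_n.+1 :=
  \row_i oapp (x.2 ord0) x.1 (unlift ord0 i).

Lemma measurable_coord n (i : 'I_n) :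
  measurable_fun [set: 'rV[R]_n] (fun x => x ord0 i : R).
Proof.
move=> _ Y mY; rewrite setTI; apply: sub_sigma_algebra.
rewrite -bigcup_seq; exists i => /=; first by rewrite mem_index_enum.
by exists Y => //; rewrite setTI.
Qed.

Lemma measurable_rVP d (T : measurableType d) n (f : T -> 'rV[R]_n) :
  (forall i, measurable_fun [set: T] (fun x => f x ord0 i : R)) ->
  measurable_fun [set: T] f.
Proof.
move=> mf; pose F := image_set_system [set: T] f measurable.
have sF : sigma_algebra [set: 'rV[R]_n] F.
  exact/sigma_algebra_image/sigma_algebra_measurable.
suff sub : measurable `<=` F by move=> _ Y /sub; rewrite /F /image_set_system.
apply: smallest_sub => //; elim/big_ind : _ => //.
  by move=> A B AF BF; rewrite subUset.
move=> i _ _ [B mB <-]; rewrite /F /image_set_system /=.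
by rewrite [X in f @^-1` X]setTI; exact: (mf i measurableT B mB).
Qed.

Lemma measurable_cons_rV n :
  measurable_fun [set: measurableTypeR R * 'rV[R]_n] (@cons_rV n).
Proof.
apply: measurable_rVP => i; under eq_fun do rewrite mxE.
case: unliftP => [j|] _ /=; last first.
  exact: (@measurable_fst _ _ (measurableTypeR R) 'rV[R]_n).
exact: (measurableT_comp (measurable_coord j) measurable_snd).
Qed.

Definition uncons_rV n (x : 'rV[R]_n.+1) : measurableTypeR R * 'rV[R]_n :=
  (x ord0 ord0, \row_j x ord0 (lift ord0 j)).

Lemma cons_rVK n : cancel (@cons_rV n) (@uncons_rV n).
Proof.
move=> [x y]; congr (_, _); first by rewrite mxE unlift_none.
by apply/rowP => j; rewrite !mxE liftK.
Qed.

Lemma uncons_rVK n : cancel (@uncons_rV n) (@cons_rV n).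
Proof.
move=> x; apply/rowP => i; rewrite mxE.
by case: unliftP => [j|] -> //=; rewrite mxE.
Qed.

Lemma measurable_uncons_rV n :
  measurable_fun [set: 'rV[R]_n.+1] (@uncons_rV n).
Proof.
apply: (@measurable_fun_pair _ _ _ 'rV[R]_n.+1 (measurableTypeR R) 'rV[R]_n).
  exact: measurable_coord.
by apply: measurable_rVP => i; under eq_fun do rewrite mxE;
  exact: measurable_coord.
Qed.

Section step.
Context (n : nat) (mu : {sigma_finite_measure set 'rV[R]_n -> \bar R}).

Definition lebesgue_rVS : set 'rV[R]_n.+1 -> \bar R :=
  pushforward (lebesgue_measure \x mu)%E (@cons_rV n).

Let lebesgue_rVS0 : (lebesgue_rVS set0 = 0)%E.
Proof. by rewrite /lebesgue_rVS /pushforward preimage_set0 measure0. Qed.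

Let lebesgue_rVS_ge0 A : (0 <= lebesgue_rVS A)%E.
Proof. by rewrite /lebesgue_rVS /pushforward; exact: measure_ge0. Qed.

Let lebesgue_rVS_sigma_additive : semi_sigma_additive lebesgue_rVS.
Proof.
move=> F mF tF mUF; rewrite /lebesgue_rVS /pushforward preimage_bigcup.
have mc A : measurable A -> measurable (@cons_rV n @^-1` A).
  by move=> mA; rewrite -[X in measurable X]setTI; exact: measurable_cons_rV.
apply: measure_semi_sigma_additive.
- by move=> k; exact: mc.
- apply/trivIsetP => /= i j _ _ ij; rewrite -preimage_setI.
  by move/trivIsetP : tF => /(_ _ _ _ _ ij) ->//; rewrite preimage_set0.
- by rewrite -preimage_bigcup; exact: mc.
Qed.

HB.instance Definition _ := isMeasure.Build _ _ _ lebesgue_rVS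
  lebesgue_rVS0 lebesgue_rVS_ge0 lebesgue_rVS_sigma_additive.

Let lebesgue_rVS_sigma_finite : sigma_finite setT lebesgue_rVS.
Proof.
have /sigma_finiteP[F [TF ndF Foo]] :=
  sigma_finiteT (@lebesgue_measure R : {sigma_finite_measure set _ -> \bar R}).
have /sigma_finiteP[G [TG ndG Goo]] := sigma_finiteT mu.
exists (fun k => @uncons_rV n @^-1` (F k `*` G k)).
  rewrite -preimage_bigcup; apply/esym/seteqP; split => // x _.
  have [i _ Fx] : (\bigcup_i F i) (uncons_rV x).1 by rewrite -TF.
  have [j _ Gx] : (\bigcup_i G i) (uncons_rV x).2 by rewrite -TG.
  exists (maxn i j) => //; split.
  - by move: Fx; apply/subsetPset/ndF/leq_maxl.
  - by move: Gx; apply/subsetPset/ndG/leq_maxr.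
move=> k; have [mF Fk] := Foo k; have [mG Gk] := Goo k; split.
  rewrite -[X in measurable X]setTI.
  by apply: measurable_uncons_rV => //; exact: measurableX.
rewrite /lebesgue_rVS /pushforward -comp_preimage.
rewrite (_ : _ \o _ = idfun); last exact/funext/cons_rVK.
rewrite preimage_id product_measure1E//.
by rewrite lte_mul_pinfty// ge0_fin_numE.
Qed.

HB.instance Definition _ := Measure_isSigmaFinite.Build _ _ _ lebesgue_rVS
  lebesgue_rVS_sigma_finite.

End step.

(* n-dimensional Lebesgue measure: dirac 0 for n = 0, then iterated products. *)
Fixpoint lebesgue_rV n : {sigma_finite_measure set 'rV[R]_n -> \bar R} :=
  if n is m.+1 then lebesgue_rVS (lebesgue_rV m) else dirac (0 : 'rV[R]_0).

End lebesgue_rV.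

(* Complex-valued functions are measured and integrated through their real and
   imaginary parts. *)
Section complex_valued.
Context (R : realType) (n : nat).
Local Notation mu := (lebesgue_rV R n).
Implicit Types f : 'rV[R]_n -> R[i].

Definition cmeasurable f :=
  measurable_fun setT (fun x => complex.Re (f x)) /\
  measurable_fun setT (fun x => complex.Im (f x)).

Definition cLnorm (p : \bar R) f : \bar R :=
  'N[mu]_p[(fun x => (ComplexField.Normc.normc (f x))%:E)]%E.

Definition cLfun (p : \bar R) f := cmeasurable f /\ (cLnorm p f < +oo)%E.

Definition clocally_integrable f := cmeasurable f /\
  forall K : set 'rV[R]_n, compact K ->
    (\int[mu]_(x in K) (ComplexField.Normc.normc (f x))%:E < +oo)%E.

Definition cintegral f : R[i] :=
  (\int[mu]_x complex.Re (f x)) +i* (\int[mu]_x complex.Im (f x)).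

End complex_valued.

Section sobolev.
Context (R : realType) (n : nat).

Definition partial (i : 'I_n) (phi : 'rV[R]_n -> R) : 'rV[R]_n -> R :=
  'D_(delta_mx ord0 i) phi.

(* [:: i1; ...; ik] stands for d_i1 (... (d_ik phi)). *)
Definition partials (s : seq 'I_n) (phi : 'rV[R]_n -> R) : 'rV[R]_n -> R :=
  foldr partial phi s.

Definition multi_partial (a : 'I_n -> nat) (phi : 'rV[R]_n -> R) :=
  partials (flatten [seq nseq (a i) i | i <- enum 'I_n]) phi.

Definition smooth (phi : 'rV[R]_n -> R) :=
  forall (s : seq 'I_n) (x : 'rV[R]_n), differentiable (partials s phi) x.

Definition test_function (phi : 'rV[R]_n -> R) :=
  smooth phi /\ compact (closure [set x | phi x != 0]).

Definition is_weak_derivative (a : 'I_n -> nat) (u v : 'rV[R]_n -> R[i]) :=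
  [/\ clocally_integrable u, clocally_integrable v &
    forall phi, test_function phi ->
      cintegral (fun x => u x * (multi_partial a phi x)%:C) =
      (-1) ^+ (\sum_i a i)%N * cintegral (fun x => v x * (phi x)%:C)].

(* Unique up to a null set when it exists. *)
Definition weak_derivative (a : 'I_n -> nat) (u : 'rV[R]_n -> R[i]) :
    'rV[R]_n -> R[i] :=
  xget (cst 0) [set v | is_weak_derivative a u v].

Definition sobolev (m : nat) (p : \bar R) (u : 'rV[R]_n -> R[i]) :=
  cLfun p u /\
  forall a : 'I_n -> nat, (\sum_i a i <= m)%N ->
    is_weak_derivative a u (weak_derivative a u) /\
    cLfun p (weak_derivative a u).

(* The multi-indices of order at most m are the a : 'I_n -> 'I_m.+1 below. *)
Definition sobolev_norm (m : nat) (p : \bar R) (u : 'rV[R]_n -> R[i]) :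
    \bar R :=
  (\sum_(a : {ffun 'I_n -> 'I_m.+1} | (\sum_i a i <= m)%N)
     cLnorm p (weak_derivative (fun i => a i) u))%E.

End sobolev.

Section fourier.
Context (R : realType) (n : nat).
Implicit Types (x xi : 'rV[R]_n) (f : 'rV[R]_n -> R[i]).

Definition cexp (z : R[i]) : R[i] :=
  (expR (complex.Re z))%:C * (cos (complex.Im z) +i* sin (complex.Im z)).

Definition dotv x xi : R := \sum_i x ord0 i * xi ord0 i.

Definition fourier f xi : R[i] :=
  cintegral (fun x => cexp (0 +i* - dotv x xi) * f x).

Definition inverse_fourier f x : R[i] :=
  ((2 * pi) ^- n)%:C *
  cintegral (fun xi => cexp (0 +i* dotv x xi) * f xi).

End fourier.

(* green_hat xi is the solution of
     G'' + |xi|^2 G' + xi_1^2 G = 0,  G(0) = 0,  G'(0) = 1,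
   with value t exp(- |xi|^2 t / 2) at the double root lambda0 xi = 0. The
   index e1 designates the distinguished direction x_1. *)
Section green.
Context (R : realType) (n : nat) (e1 : 'I_n).
Implicit Types (x xi : 'rV[R]_n) (t : R).

(* |xi|^2 for the Euclidean norm; the library norm on 'rV[R]_n is the sup norm. *)
Definition normsq xi : R := dotv xi xi.

Definition lambda0 xi : R[i] :=
  sqrtc (normsq xi ^+ 2 - 4 * xi ord0 e1 ^+ 2)%:C.

Definition lambdap xi : R[i] := (- (normsq xi)%:C + lambda0 xi) / 2.

Definition lambdam xi : R[i] := (- (normsq xi)%:C - lambda0 xi) / 2.

Definition green_hat xi t : R[i] :=
  if lambda0 xi == 0 then (t * expR (- normsq xi * t / 2))%:C
  else (cexp (lambdap xi * t%:C) - cexp (lambdam xi * t%:C)) / lambda0 xi.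

Definition cderive1 (g : R -> R[i]) t : R[i] :=
  derive1 (fun s => complex.Re (g s)) t +i*
  derive1 (fun s => complex.Im (g s)) t.

Definition solution_hat (u0 u1 : 'rV[R]_n -> R[i]) t xi : R[i] :=
  (cderive1 (green_hat xi) t + (normsq xi)%:C * green_hat xi t) *
    fourier u0 xi +
  green_hat xi t * fourier u1 xi.

(* For u0, u1 in W^{n+1,1} and t > 0 the function solution_hat u0 u1 t is
   integrable, so its inverse Fourier transform is an absolutely convergent
   integral. *)
Definition solution (u0 u1 : 'rV[R]_n -> R[i]) t x : R[i] :=
  inverse_fourier (solution_hat u0 u1 t) x.

End green.

(* Main.v *)
Require Import Defs.
From mathcomp Require Import all_boot all_order all_algebra.
From mathcomp Require Import all_classical all_reals all_analysis.
From mathcomp Require Import measurable_realfun ess_sup_inf.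
From mathcomp Require Import complex ring lra.

(* Write G for green_hat, a = |xi|^2, b = |xi_1|. The solution is bounded by the
   L^1 norm of its Fourier transform. Pairing the weak derivatives of u with a
   rescaled smooth cutoff times cos(x.xi + d) and letting the cutoff tend to a
   constant gives |u^(xi)| <= C ||u|| / (1 + |xi|^(n+1)), so everything reduces to
     int (|G' + a G| + |G|) / (1 + |xi|^(n+1)) dxi <= C t^(-1/2).
   - If a <= 2b (complex or double roots), both multipliers are at most
     (2 + t) exp(-a t/4); for t >= 1 the Gaussian integral gives t^(1 - n/2),
     which is at most t^(-1/2) because n >= 3.
   - If a > 2b (real roots), they are at most (5 + 8/a) exp(-b^2 t/(2a)). With
     xi = (xi_1, eta): if b^2 > |eta|^2 then a <= 2b^2 and the exponential is at
     most t^(-1/2); otherwise a <= 2|eta|^2 and integrating in xi_1 first produces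
     t^(-1/2) times |eta| + 1/|eta|, which is integrable in dimension n - 1 >= 2
     against the weight.
   The integrals over R^n are bounded by decomposing into dyadic cubes. *)

Set Implicit Arguments.
Unset Strict Implicit.
Unset Printing Implicit Defensive.

Import Order.TTheory GRing.Theory Num.Theory.
Import numFieldNormedType.Exports.

Local Open Scope classical_set_scope.
Local Open Scope ring_scope.
Local Open Scope complex_scope.

(** * Upper bounds for integrals, Gaussians and cubes *)

(** The rate comes from the larger real root, of order [- b^2/a] when [b] is small: damping is lost
    on the hyperplane [xi_1 = 0], so the decay there is that of a one-dimensional Gaussian in
    [xi_1], of width about [|eta| t^(-1/2)]. Against the singularity [1/a] of [G] at low frequency
    this width leaves [1/|eta|]; at high frequency it costs one power of [|eta|], and a weight of
    order [n+1] still leaves a factor [2^-k] on the shell [|eta| ~ 2^k]. Sizes are measured in the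
    sup norm for two reasons. Its balls are products of intervals, whose measure follows from the
    iterated construction of [lebesgue_rV]. Its value is a single coordinate, so the decay of [u^]
    uses only pure derivatives of order 0 and [n+1] in that coordinate. Integrals are controlled by
    measurable majorants ([upint_le]), so that the multipliers, defined by cases, enter only through
    pointwise inequalities. *)

Section upper_integral.
Context d (T : measurableType d) (R : realType).
Variable mu : {measure set T -> \bar R}.
Implicit Types (f g h : T -> R) (M : R).

(* h need not be measurable: the integral of a nonnegative function, being a
   supremum over simple functions, is monotone without measurability. *)
Definition upint_le h M := exists H : T -> \bar R,
  [/\ measurable_fun [set: T] H, (forall x, 0 <= H x)%E,
      (forall x, (h x)%:E <= H x)%E & (\int[mu]_x H x <= M%:E)%E].

Lemma upint_le_mono h h' M : (forall x, h x <= h' x) ->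
  upint_le h' M -> upint_le h M.
Proof.
move=> hh' [H [mH H0 hH HM]]; exists H; split => // x.
by rewrite (le_trans _ (hH x))// lee_fin.
Qed.

Lemma upint_le_bound h M M' : M <= M' -> upint_le h M -> upint_le h M'.
Proof.
move=> MM' [H [mH H0 hH HM]]; exists H; split => //.
by rewrite (le_trans HM)// lee_fin.
Qed.

Lemma upint_leD h h' M M' : upint_le h M -> upint_le h' M' ->
  upint_le (fun x => h x + h' x) (M + M').
Proof.
move=> [H [mH H0 hH HM]] [H' [mH' H0' hH' HM']].
exists (fun x => H x + H' x)%E; split => //.
- exact: emeasurable_funD.
- by move=> x; rewrite adde_ge0.
- by move=> x; rewrite EFinD leeD.
- by rewrite ge0_integralD// EFinD leeD.
Qed.

Lemma upint_leZ (c : R) h M : 0 <= c -> upint_le h M ->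
  upint_le (fun x => c * h x) (c * M).
Proof.
move=> c0 [H [mH H0 hH HM]].
exists (fun x => c%:E * H x)%E; split => //.
- exact: measurable_funeM.
- by move=> x; rewrite mule_ge0.
- by move=> x; rewrite EFinM lee_wpmul2l.
- by rewrite ge0_integralZl_EFin// EFinM lee_wpmul2l.
Qed.

(** The majorant is the series of the [f k]: being nonnegative, it dominates each of its terms, and
    one good term per point suffices. *)
Lemma upint_le_dyadic h (f : nat -> T -> R) M :
  (forall k, measurable_fun [set: T] (f k)) -> (forall k x, 0 <= f k x) ->
  (forall x, exists k, h x <= f k x) ->
  (forall k, \int[mu]_x (f k x)%:E <= (M / 2 ^+ k)%:E)%E ->
  upint_le h (2 * M).
Proof.
move=> mf f0 hf fM; exists (fun x => \sum_(k <oo) (f k x)%:E)%E; split.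
- apply: (@ge0_emeasurable_sum _ _ _ _ (fun k x => (f k x)%:E) xpredT).
    by move=> k x _ _; rewrite lee_fin.
  by move=> k _; exact/measurable_EFinP.
- by move=> x; apply: nneseries_ge0 => k _ _; rewrite lee_fin.
- move=> x; have [k hk] := hf x.
  apply: (@le_trans _ _ (\sum_(i < k.+1) (f i x)%:E)%E).
    rewrite big_ord_recr/= (@le_trans _ _ (f k x)%:E) ?lee_fin// leeDr//.
    by apply: sume_ge0 => i _; rewrite lee_fin.
  rewrite -(big_mkord xpredT (fun i => (f i x)%:E)).
  by apply: nneseries_lim_ge => i _; rewrite lee_fin.
- rewrite integral_nneseries//; last 2 first.
  + by move=> k; exact/measurable_EFinP.
  + by move=> k x _; rewrite lee_fin.
  apply: (@le_trans _ _ (\sum_(k <oo) (M / 2 ^+ k)%:E)%E).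
    apply: lee_nneseries => [k _ _|k _]; last exact: fM.
    by apply: integral_ge0 => x _; rewrite lee_fin.
  (* [epsilon_trick0] sums [eps / 2^(k+1)]; for [eps = 2 * M] these are the bounds [M / 2 ^+ k]. *)
  apply: le_trans (epsilon_trick0 xpredT (_ : 0 <= 2 * M)).
    apply: lee_nneseries => [k _ _|k _].
      by apply: le_trans (fM k); apply: integral_ge0 => x _; rewrite lee_fin.
    rewrite lee_fin expnS natrM natrX.
    by rewrite le_eqVlt; apply/orP; left; apply/eqP; field; rewrite expf_neq0.
  rewrite mulr_ge0// -lee_fin; have := fM 0%N; rewrite expr0 divr1.
  by apply: le_trans; apply: integral_ge0 => x _; rewrite lee_fin.
Qed.

(** The positive and negative parts both lie below the majorant, so their integrals are in [[0, M]]
    and the difference is in [[-M, M]], without doubling the constant. *)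
Lemma Rintegral_upint g M : upint_le (fun x => `|g x|) M ->
  `|\int[mu]_x g x| <= M.
Proof.
move=> [H [mH H0 gH HM]].
have P (u : T -> \bar R) : (forall x, 0 <= u x)%E -> (forall x, u x <= H x)%E ->
    (\int[mu]_x u x <= M%:E)%E.
  move=> u0 uH; apply: le_trans HM; rewrite !ge0_integralTE//.
  apply: le_ereal_sup => _ [s su <-].
  by exists s => // x; exact: le_trans (su x) (uH x).
have gH2 (x : T) : (`|(g x)%:E| <= H x)%E by exact: gH.
have Pp : (\int[mu]_x (fun x => (g x)%:E)^\+ x <= M%:E)%E.
  apply: P => x //; apply: le_trans (gH2 x).
  by rewrite funeposE ge_max lee_abs abse_ge0.
have Pn : (\int[mu]_x (fun x => (g x)%:E)^\- x <= M%:E)%E.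
  apply: P => x //; apply: le_trans (gH2 x).
  by rewrite funenegE ge_max -abseN lee_abs abse_ge0.
rewrite /Rintegral integralE.
set a := integral _ _ _ in Pp *; set b := integral _ _ _ in Pn *.
have a0 : (0 <= a)%E by exact: integral_ge0.
have b0 : (0 <= b)%E by exact: integral_ge0.
case: a b a0 b0 Pp Pn => [a||] [b||] //; rewrite !lee_fin => a0 b0 Pp Pn.
by rewrite -EFinB/= ler_norml; lra.
Qed.

End upper_integral.

(** Written by coordinates so that [cons_rV] pulls it back to an interval times a cube of one
    dimension less. *)
Definition cube (R : realType) n (r : R) : set 'rV[R]_n :=
  [set x | forall i, `|x ord0 i| <= r].

Section cube_volume.
Context (R : realType).

Lemma measurable_cube n (r : R) : measurable (@cube R n r).
Proof.
have -> : @cube R n r = \bigcap_(i in [set: 'I_n])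
    ((fun x : 'rV[R]_n => x ord0 i : R) @^-1` `[-r, r]%classic).
  apply/seteqP; split=> [x xr i _ | x xr i].
    by rewrite /preimage/= in_itv/= -ler_norml.
  by have := xr i I; rewrite /preimage/= in_itv/= -ler_norml.
apply: fin_bigcap_measurable => // i _.
by rewrite -[X in measurable X]setTI; exact: measurable_coord.
Qed.

Lemma lebesgue_rV_cube n (r : R) : 0 <= r ->
  lebesgue_rV R n (cube r) = ((2 * r) ^+ n)%:E.
Proof.
move=> r0; elim: n => [|n IH].
  rewrite /= diracE mem_set ?expr0//.
  by case.
rewrite /= /lebesgue_rVS /pushforward.
have -> : @cons_rV R n @^-1` cube r = `[-r, r]%classic `*` cube r.
  apply/seteqP; split=> [[x y]|[x y]].
    move=> H; split => /=.
      by have := H ord0; rewrite /= mxE unlift_none/= in_itv/= -ler_norml.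
    by move=> i; have := H (lift ord0 i); rewrite /= mxE liftK.
  move=> [/= ]; rewrite in_itv/= -ler_norml => xr yr i.
  by rewrite /= mxE; case: unliftP => [j|] _ //=.
rewrite product_measure1E//; last exact: measurable_cube.
have -> : (lebesgue_rV R n) (cube r) = ((2 * r) ^+ n)%:E by exact: IH.
have E : lebesgue_measure (`[-r, r]%classic : set R) = (2 * r)%:E.
  rewrite lebesgue_measure_itv/= lte_fin; case: ifPn => [_|].
    by rewrite -EFinB; congr EFin; ring.
  by rewrite -leNgt => rr; congr EFin; lra.
by rewrite [X in (X * _)%E](_ : _ = (2 * r)%:E) -?EFinM -?exprS.
Qed.

End cube_volume.

Section gaussian_times_cube.
Context (R : realType).

(** The normal density has total mass 1 and prefactor [normal_peak s], the inverse of the right-hand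
    side. *)
Lemma integral_normal_fun (s : R) : 0 < s ->
  (\int[lebesgue_measure]_x (normal_fun 0 s x)%:E =
   (Num.sqrt (s ^+ 2 * pi *+ 2))%:E)%E.
Proof.
move=> s0; have s0' : s != 0 by rewrite gt_eqF.
have := integral_normal_pdf 0 s; rewrite normal_pdfE//.
have p0 := normal_peak_gt0 s0'.
under eq_integral do rewrite EFinM.
rewrite ge0_integralZl_EFin ?ltW//; last 2 first.
- by move=> x _; rewrite lee_fin normal_fun_ge0.
- by apply/measurable_EFinP; exact: (measurable_normal_fun 0 s).
move=> h; have -> : Num.sqrt (s ^+ 2 * pi *+ 2) = (normal_peak s)^-1.
  by rewrite /normal_peak invrK.
have -> : ((normal_peak s)^-1%:E = (normal_peak s)^-1%:E * 1 :> \bar R)%E.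
  by rewrite mule1.
by rewrite -h muleA -EFinM mulVf ?gt_eqF// mul1e.
Qed.

(** The building block of the majorant in [upint_le_conic]. The two factors involve separate
    coordinates, so Tonelli computes its integral exactly. *)
Definition gauss_cube m (s r : R) (x : 'rV[R]_m.+1) : R :=
  normal_fun 0 s (x ord0 ord0) * \1_(cube r) ((uncons_rV x).2).

Lemma measurable_gauss_cube m (s r : R) :
  measurable_fun [set: 'rV[R]_m.+1] (gauss_cube s r).
Proof.
apply: measurable_funM.
  apply: (measurableT_comp (measurable_normal_fun 0 s)).
  exact: measurable_coord.
apply: (measurableT_comp (measurable_indic (measurable_cube r))).
exact: (measurableT_comp measurable_snd (@measurable_uncons_rV R m)).
Qed.

Lemma integral_gauss_cube m (s r : R) : 0 < s -> 0 <= r ->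
  (\int[lebesgue_rV R m.+1]_x (gauss_cube s r x)%:E =
   (Num.sqrt (s ^+ 2 * pi *+ 2) * (2 * r) ^+ m)%:E)%E.
Proof.
move=> s0 r0; rewrite /= /lebesgue_rVS.
have m1 : measurable_fun [set: 'rV[R]_m] (\1_(cube r) : 'rV[R]_m -> R).
  by apply: measurable_indic; exact: measurable_cube.
have m2 : measurable_fun [set: measurableTypeR R] (normal_fun 0 s).
  exact: measurable_normal_fun.
have E p : gauss_cube s r (@cons_rV R m p) = normal_fun 0 s p.1 * \1_(cube r) p.2.
  by rewrite /gauss_cube cons_rVK /= mxE unlift_none.
rewrite (ge0_integral_pushforward (@measurable_cons_rV R m))//=; last 2 first.
- by apply/measurable_EFinP; exact: measurable_gauss_cube.
- move=> x _; rewrite lee_fin /gauss_cube mulr_ge0 ?normal_fun_ge0//.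
rewrite preimage_setT.
under eq_integral do rewrite /= E.
rewrite fubini_tonelli1//=; last 2 first.
- apply/measurable_EFinP; apply: measurable_funM.
    exact: (measurableT_comp m2 (@measurable_fst _ _ (measurableTypeR R) 'rV[R]_m)).
  exact: (measurableT_comp m1 (@measurable_snd _ _ (measurableTypeR R) 'rV[R]_m)).
- by move=> p; rewrite lee_fin mulr_ge0 ?normal_fun_ge0.
rewrite /fubini_F /=.
transitivity (\int[lebesgue_measure]_x (((2 * r) ^+ m)%:E * (normal_fun 0 s x)%:E))%E.
  apply: eq_integral => x _.
  under eq_integral do rewrite EFinM.
  rewrite ge0_integralZl_EFin ?normal_fun_ge0//; last exact/measurable_EFinP.
  rewrite integral_indic ?setIT//; last exact: measurable_cube.
  by rewrite muleC; congr (_ * _)%E; exact: lebesgue_rV_cube.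
rewrite ge0_integralZl_EFin ?exprn_ge0 ?mulr_ge0//; last 2 first.
- by move=> x _; rewrite lee_fin normal_fun_ge0.
- by apply/measurable_EFinP; exact: (measurable_normal_fun 0 s).
by rewrite integral_normal_fun// -EFinM mulrC.
Qed.

End gaussian_times_cube.

(** * Dyadic decompositions *)

Section supremum_norm.
Context (R : realType) (n : nat).
Implicit Types x : 'rV[R]_n.

Definition supn x : R := \big[Num.max/0]_i `|x ord0 i|.

Lemma supn_ge0 x : 0 <= supn x.
Proof. exact: bigmax_ge_id. Qed.

Lemma le_supn x i : `|x ord0 i| <= supn x.
Proof. exact: le_bigmax. Qed.

Lemma cube_supn x (r : R) : supn x <= r -> cube r x.
Proof. by move=> xr i; exact: le_trans (le_supn x i) xr. Qed.

Lemma supn_eq (i0 : 'I_n) x : exists i, supn x = `|x ord0 i|.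
Proof.
rewrite /supn (@bigmax_eq_arg _ _ _ 0 i0)//.
by eexists.
Qed.

End supremum_norm.

Lemma exp2_cover (R : realType) (y : R) : 1 <= y ->
  exists k : nat, 2 ^+ k <= y < 2 ^+ k.+1.
Proof.
move=> y1; have y0 : 0 <= y by lra.
have /andP[ty yt] := truncn_itv y0.
have t0 : (0 < Num.truncn y)%N.
  by rewrite lt0n; apply/eqP => t0; rewrite t0 in yt; lra.
have /andP[kt tk] := trunc_log_bounds (isT : (1 < 2)%N) t0.
exists (trunc_log 2 (Num.truncn y)); apply/andP; split.
  by apply: le_trans ty; rewrite -natrX ler_nat.
by apply: lt_le_trans yt _; rewrite -natrX ler_nat.
Qed.

Section dyadic_bounds.
Context (R : realType).

(** On the shell [2^k <= l |x| < 2^(k+1)] the function is at most [2^(-k(n+1))], and the enclosing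
    cube has volume [(4 * 2^k / l)^n]. The exponent exceeds the dimension by one, which leaves
    [2^-k]. *)
Lemma upint_le_radial n (l : R) (h : 'rV[R]_n -> R) : 0 < l ->
  (forall x, h x <= 1) ->
  (forall x, 1 <= l * supn x -> h x <= (l * supn x) ^- n.+1) ->
  upint_le (lebesgue_rV R n) h (2 * (4 ^+ n / l ^+ n)).
Proof.
move=> l0 h1 hr.
pose r k : R := 2 ^+ k.+1 / l.
have r0 k : 0 < r k by rewrite divr_gt0.
pose f k (x : 'rV[R]_n) : R := 2 ^- (k * n.+1) * \1_(cube (r k)) x.
have mf k : measurable_fun [set: 'rV[R]_n] (f k).
  by apply: measurable_funM => //; apply: measurable_indic; exact: measurable_cube.
have fx k x : supn x <= r k -> f k x = 2 ^- (k * n.+1).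
  by move=> /cube_supn xr; rewrite /f indicE mem_set// mulr1.
apply: (@upint_le_dyadic _ _ _ _ _ f).
- exact: mf.
- by move=> k x; rewrite mulr_ge0.
- move=> x; have [lx|lx] := leP 1 (l * supn x); last first.
    (* The core [l * supn x < 1] is put into the cube of index 0, where [f 0] equals 1. *)
    exists 0%N; rewrite fx ?mul0n ?expr0 ?invr1//.
    by rewrite /r expr1 ler_pdivlMr// mulrC; lra.
  have [k /andP[k1 k2]] := exp2_cover lx.
  exists k; rewrite fx; last by rewrite /r ler_pdivlMr// mulrC ltW.
  apply: le_trans (hr _ lx) _; rewrite exprM lef_pV2 ?posrE ?exprn_gt0//; last first.
    by apply: lt_le_trans k1; rewrite exprn_gt0.
  by rewrite lerXn2r ?nnegrE ?exprn_ge0//; lra.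
- move=> k; under eq_integral do rewrite EFinM.
  rewrite ge0_integralZl_EFin//; last first.
    by apply/measurable_EFinP; apply: measurable_indic; exact: measurable_cube.
  rewrite integral_indic ?setIT//; last exact: measurable_cube.
  rewrite [X in (_ * X)%E](@lebesgue_rV_cube R n _ (ltW (r0 k))).
  rewrite -EFinM lee_fin le_eqVlt; apply/orP; left; apply/eqP.
  have -> : 2 * r k = 4 * 2 ^+ k / l.
    by rewrite /r exprS; field; rewrite gt_eqF.
  rewrite !exprMn exprVn mulnS exprD exprM -exprVn.
  have : 0 < (2 ^+ k) ^+ n :> R by rewrite !exprn_gt0.
  have : 0 < 2 ^+ k :> R by rewrite !exprn_gt0.
  move: (2 ^+ k : R) => a a0; move: (a ^+ n) => b b0.
  by rewrite exprVn; field; rewrite !gt_eqF ?exprn_gt0.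
Qed.

(* With x = (xi_1, eta) and r = |eta|_sup, the factor m r^2 in the exponent is an
   upper bound for |eta|^2. *)
Lemma upint_le_conic m : (2 <= m)%N -> exists2 C : R, 0 <= C &
  forall (t : R) (h : 'rV[R]_m.+1 -> R), 0 < t ->
  (forall x, let r := supn (uncons_rV x).2 in
     let K := expR (- (x ord0 ord0 ^+ 2 * t / (4 * m%:R * r ^+ 2))) * (1 + r ^- 2) in
     h x <= 0 \/ [/\ 0 < r, h x <= K & h x <= K * r ^- m.+2]) ->
  upint_le (lebesgue_rV R m.+1) h (C / Num.sqrt t).
Proof.
move=> m2.
(* The square roots come from [kap] and from the mass of the Gaussian; [4 * 4 ^+ m] is the share of
   the shells with [r >= 1], and [8 * 2 ^+ m] that of the shells with [r < 1]. *)
pose M : R := Num.sqrt (2 * m%:R) * Num.sqrt (2 * pi) * (4 * 4 ^+ m + 8 * 2 ^+ m).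
have M0 : 0 <= M by rewrite mulr_ge0 ?addr_ge0 ?mulr_ge0 ?sqrtr_ge0.
exists (2 * M); first by rewrite mulr_ge0.
move=> t h t0 H; rewrite -mulrA.
have m0 : 0 < m%:R :> R by rewrite ltr0n; case: (m) m2.
(* Chosen so that a standard deviation [r * kap] gives the exponent [xi_1^2 t / (4 m r^2)] of the
   hypothesis. The factor [1 / sqrt t] of the conclusion enters here. *)
pose kap : R := Num.sqrt (2 * m%:R) / Num.sqrt t.
have st0 : 0 < Num.sqrt t by rewrite sqrtr_gt0.
have kap0 : 0 < kap by rewrite divr_gt0 ?sqrtr_gt0 ?mulr_gt0.
have kap2 : kap ^+ 2 = 2 * m%:R / t.
  by rewrite exprMn exprVn !sqr_sqrtr ?ltW// mulr_gt0.
pose g r : 'rV[R]_m.+1 -> R := gauss_cube (r * kap) r.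
have g0 r x : 0 <= g r x by rewrite /g/gauss_cube mulr_ge0 ?normal_fun_ge0.
pose r1 k : R := 2 ^+ k.+1; pose r2 k : R := 2 ^- k.
have r10 k : 0 < r1 k by rewrite exprn_gt0.
have r20 k : 0 < r2 k by rewrite invr_gt0 exprn_gt0.
(* The first term serves [2^k <= r < 2^(k+1)], where [1 + r^-2 <= 2]; the second serves
   [2^-(k+1) < r <= 2^-k], where [1 + r^-2 <= 2 r^-2 <= 2 * 4^(k+1)]. *)
pose f k x : R := 2 * 2 ^- (k * m.+2) * g (r1 k) x + 2 * 4 ^+ k.+1 * g (r2 k) x.
have f10 k x : 0 <= 2 * 2 ^- (k * m.+2) * g (r1 k) x.
  by rewrite mulr_ge0// mulr_ge0// invr_ge0 exprn_ge0.
have f20 k x : 0 <= 2 * 4 ^+ k.+1 * g (r2 k) x.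
  by rewrite mulr_ge0// mulr_ge0// exprn_ge0.
have gx r x : 0 < supn (uncons_rV x).2 -> supn (uncons_rV x).2 <= r ->
    expR (- (x ord0 ord0 ^+ 2 * t / (4 * m%:R * supn (uncons_rV x).2 ^+ 2))) <= g r x.
  set s := supn _ => s0 sr; have r0 : 0 < r by lra.
  rewrite /g /gauss_cube indicE mem_set; last exact: cube_supn.
  rewrite mulr1 /normal_fun subr0 ler_expR mulNr lerN2 exprMn kap2.
  have -> : r ^+ 2 * (2 * m%:R / t) *+ 2 = 4 * m%:R * r ^+ 2 / t.
    by rewrite -mulr_natl; field; rewrite gt_eqF.
  rewrite invf_div mulrA.
  apply: ler_wpM2l; first by rewrite mulr_ge0 ?sqr_ge0 ?ltW.
  rewrite lef_pV2 ?posrE ?mulr_gt0 ?exprn_gt0//.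
  by rewrite ler_wpM2l ?mulr_ge0// lerXn2r ?nnegrE// ltW.
apply: (@upint_le_dyadic _ _ _ _ _ f).
- move=> k; apply: (@measurable_funD _ _ _ _ (fun x => _ * g _ x) (fun x => _ * g _ x)).
    by apply: measurable_funM => //; exact: measurable_gauss_cube.
  by apply: measurable_funM => //; exact: measurable_gauss_cube.
- by move=> k x; rewrite addr_ge0.
- move=> x; case: (H x) => [hx0|].
    by exists 0%N; apply: le_trans hx0 _; rewrite addr_ge0.
  have := gx _ x; set E := expR _; set s := supn _ => {}gx [s0 hK hKr].
  have s0' := ltW s0.
  have E0 : 0 <= E by exact: expR_ge0.
  have [s1|s1] := leP 1 s.
    have [k /andP[k1 k2]] := exp2_cover s1; exists k.
    apply: (@le_trans _ _ (2 * 2 ^- (k * m.+2) * g (r1 k) x)); last first.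
      by rewrite lerDl.
    apply: le_trans hKr _; rewrite -mulrA mulrC.
    apply: ler_pM; rewrite ?mulr_ge0 ?addr_ge0 ?invr_ge0 ?exprn_ge0//; last first.
     by apply: gx => //; exact: ltW.
    apply: ler_pM; rewrite ?mulr_ge0 ?addr_ge0 ?invr_ge0 ?exprn_ge0//.
      suff : s ^- 2 <= 1 by lra.
      by rewrite invf_le1 ?exprn_gt0// exprn_ege1.
    rewrite exprM lef_pV2 ?posrE ?exprn_gt0//.
    by rewrite lerXn2r ?nnegrE ?exprn_ge0.
  have s1' : 1 <= s^-1 by rewrite invf_ge1// ltW.
  have [k /andP[k1 k2]] := exp2_cover s1'; exists k.
  apply: (@le_trans _ _ (2 * 4 ^+ k.+1 * g (r2 k) x)); last first.
    by rewrite lerDr.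
  apply: le_trans hK _; rewrite mulrC.
  apply: ler_pM; rewrite ?mulr_ge0 ?addr_ge0 ?invr_ge0 ?exprn_ge0//; last first.
    apply: gx => //; rewrite -(invrK s) lef_pV2 ?posrE ?exprn_gt0//.
    by rewrite invr_gt0.
  have -> : (4 : R) = 2 ^+ 2 by ring.
  have s21 : 1 <= s^-1 ^+ 2 by rewrite exprn_ege1.
  have : s^-1 ^+ 2 <= (2 ^+ 2) ^+ k.+1.
    by rewrite exprAC lerXn2r ?nnegrE ?exprn_ge0 ?invr_ge0// ltW.
  by rewrite exprVn in s21 *; lra.
- have mg r : measurable_fun [set: 'rV[R]_m.+1] (fun x => (g r x)%:E).
    by apply/measurable_EFinP; exact: measurable_gauss_cube.
  have I c r : 0 <= c -> 0 < r ->
      (\int[lebesgue_rV R m.+1]_x (c * g r x)%:E =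
       (c * (r * kap * Num.sqrt (2 * pi) * (2 * r) ^+ m))%:E)%E.
    move=> c0 r0; under eq_integral do rewrite EFinM.
    rewrite ge0_integralZl_EFin//; last by move=> x _; rewrite lee_fin.
    rewrite [X in (_ * X)%E](integral_gauss_cube _ (mulr_gt0 r0 kap0) (ltW r0)).
    have -> : (r * kap) ^+ 2 * pi *+ 2 = (r * kap) ^+ 2 * (2 * pi) by ring.
    by rewrite -EFinM sqrtrM ?sqr_ge0// sqrtr_sqr gtr0_norm// mulr_gt0.
  move=> k; under eq_integral do rewrite EFinD.
  rewrite ge0_integralD//; last 4 first.
  + by move=> x _; rewrite lee_fin.
  + apply/measurable_EFinP; apply: measurable_funM => //.
    exact: measurable_gauss_cube.
  + by move=> x _; rewrite lee_fin.
  + apply/measurable_EFinP; apply: measurable_funM => //.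
    exact: measurable_gauss_cube.
  rewrite !I ?mulr_ge0 ?invr_ge0 ?exprn_ge0// -EFinD lee_fin.
  have -> : M / Num.sqrt t / 2 ^+ k = kap * Num.sqrt (2 * pi) *
      (4 * 4 ^+ m / 2 ^+ k + 8 * 2 ^+ m / 2 ^+ k).
    by rewrite /M /kap; field; rewrite gt_eqF ?exprn_gt0//= gt_eqF.
  set w := kap * _; have w0 : 0 <= w by rewrite mulr_ge0 ?sqrtr_ge0// ltW.
  have -> : 2 / 2 ^+ (k * m.+2) * (r1 k * kap * Num.sqrt (2 * pi) * (2 * r1 k) ^+ m)
      + 2 * 4 ^+ k.+1 * (r2 k * kap * Num.sqrt (2 * pi) * (2 * r2 k) ^+ m)
    = w * (2 / 2 ^+ (k * m.+2) * (r1 k * (2 * r1 k) ^+ m) +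
           2 * 4 ^+ k.+1 * (r2 k * (2 * r2 k) ^+ m)).
    by rewrite /w; ring.
  apply: ler_wpM2l => //; rewrite /r1 /r2.
  have a0 : 0 < 2 ^+ k :> R by rewrite exprn_gt0.
  apply: lerD.
    rewrite exprM !exprS !exprMn.
    have -> : (4 : R) ^+ m = 2 ^+ m * 2 ^+ m by rewrite -exprMn; congr (_ ^+ _); ring.
    have : 0 < (2 ^+ k) ^+ m :> R by rewrite !exprn_gt0.
    move: (2 ^+ k : R) a0 => a a0; move: (a ^+ m) (2 ^+ m : R) => b c b0.
    by rewrite le_eqVlt; apply/orP; left; apply/eqP; field; rewrite !gt_eqF.
  rewrite exprMn exprVn exprS.
  have -> : (4 : R) ^+ k = 2 ^+ k * 2 ^+ k by rewrite -exprMn; congr (_ ^+ _); ring.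
  have a1 : 1 <= 2 ^+ k :> R by rewrite exprn_ege1// ler1n.
  (* The small shells contribute about [4^k * 2^(-k(m+1))], which is at most [2^-k] because
     [m >= 2]. *)
  have : (2 ^+ k) ^+ 2 <= (2 ^+ k) ^+ m :> R by rewrite ler_weXn2l.
  move: (2 ^+ k : R) a0 a1 => a a0 a1; have : 0 < a ^+ m by rewrite exprn_gt0.
  have : 0 <= 2 ^+ m :> R by rewrite exprn_ge0.
  move: (a ^+ m) (2 ^+ m : R) => b c c0 b0 ab.
  have -> : 2 * (4 * (a * a)) * (a^-1 * (c * b^-1)) = 8 * c / a * (a ^+ 2 / b).
    by field; rewrite !gt_eqF.
  rewrite ler_piMr ?mulr_ge0 ?invr_ge0 ?(ltW a0)//.
  by rewrite ler_pdivrMr ?mul1r.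
Qed.

End dyadic_bounds.

(** * The Green function *)

Section green_function.
Context (R : realType).
Implicit Types a b l w t c : R.

Lemma is_derive1_comp_eq (f g : R -> R) t a b e :
  is_derive (g t) 1 f a -> is_derive t 1 g b -> a * b = e ->
  is_derive t 1 (fun s => f (g s)) e.
Proof. by move=> df dg <-; exact: is_derive1_comp. Qed.

Lemma is_derive1M (f g : R -> R) t a b e :
  is_derive t 1 f a -> is_derive t 1 g b -> f t * b + g t * a = e ->
  is_derive t 1 (fun s => f s * g s) e.
Proof. by move=> df dg <-; exact: is_deriveM. Qed.

Lemma is_derive1B (f g : R -> R) t a b e :
  is_derive t 1 f a -> is_derive t 1 g b -> a - b = e ->
  is_derive t 1 (fun s => f s - g s) e.
Proof. by move=> df dg <-; exact: is_deriveB. Qed.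

Lemma is_derive1_scale c t : is_derive t 1 (fun s => c * s) c.
Proof.
have := @is_deriveZ _ _ _ id c t 1 1 (is_derive_id t 1).
by rewrite /GRing.scale/= mulr1.
Qed.

Lemma is_derive_expRM c t :
  is_derive t 1 (fun s => expR (c * s)) (c * expR (c * t)).
Proof.
apply: (@is_derive1_comp_eq expR ( *%R c)) (is_derive1_scale c t) _.
by rewrite mulrC.
Qed.

Lemma is_derive_sinM c t :
  is_derive t 1 (fun s => sin (c * s)) (c * cos (c * t)).
Proof.
apply: (@is_derive1_comp_eq sin ( *%R c)) (is_derive1_scale c t) _.
ring.
Qed.

(** These are the three real forms of the Green function: real roots at distance [l], a double root,
    and conjugate roots with imaginary parts [w/2] and [-w/2]. *)
Definition green_over a l t := (expR ((- a + l) / 2 * t) - expR ((- a - l) / 2 * t)) / l.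
Definition green_double a t := t * expR (- a * t / 2).
Definition green_under a w t := 2 * (expR (- a / 2 * t) * sin (w / 2 * t)) / w.

Lemma derive1_green_over a l t : derive1 (green_over a l) t =
  ((- a + l) / 2 * expR ((- a + l) / 2 * t) -
   (- a - l) / 2 * expR ((- a - l) / 2 * t)) / l.
Proof.
rewrite derive1E; apply: derive_val; apply: is_derive1M
  (is_derive1B (is_derive_expRM _ _) (is_derive_expRM _ _) erefl)
  (is_derive_cst _ _ _) _.
by rewrite mulr0 add0r mulrC.
Qed.

Lemma derive1_green_double a t : derive1 (green_double a) t =
  (1 - a / 2 * t) * expR (- a * t / 2).
Proof.
have -> : green_double a = (fun s => s * expR (- a / 2 * s)).
  by apply/funext => s; congr (_ * expR _); ring.
rewrite derive1E; apply: derive_val.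
apply: is_derive1M (is_derive_expRM _ _) _.
have -> : - a * t / 2 = - a / 2 * t by ring.
ring.
Qed.

Lemma derive1_green_under a w t : w != 0 -> derive1 (green_under a w) t =
  - a / 2 * green_under a w t + expR (- a / 2 * t) * cos (w / 2 * t).
Proof.
move=> w0; rewrite derive1E; apply: derive_val.
have -> : green_under a w = (fun s => 2 / w * (expR (- a / 2 * s) * sin (w / 2 * s))).
  by apply/funext => s; rewrite /green_under; ring.
apply: is_derive1M (is_derive_cst _ _ _)
  (is_derive1M (is_derive_expRM _ _) (is_derive_sinM _ _) erefl) _.
rewrite /green_under mulr0 addr0 (_ : cst _ t = 2 / w)//; by field.
Qed.

Lemma normr_sin_le (x : R) : `|sin x| <= `|x|.
Proof.
have H (y : R) : 0 <= y -> `|sin y| <= y.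
  move=> y0; have [|c _] := @MVT_segment R sin cos 0 y y0.
    by apply: continuous_subspaceT => z; exact: continuous_sin.
  rewrite sin0 !subr0 => ->; rewrite normrM (ger0_norm y0) ler_piMl//.
  by rewrite ler_norml cos_geN1 cos_le1.
have [x0|x0] := leP 0 x; first by rewrite (ger0_norm x0) H.
by rewrite -normrN -sinN (ltr0_norm x0) H//; lra.
Qed.

Lemma mul_expRN_le (x c : R) : 0 <= x -> 0 < c -> x * expR (- (x * c)) <= c^-1.
Proof.
move=> x0 c0; rewrite expRN ler_pdivrMr ?expR_gt0//.
by rewrite (mulrC c^-1) ler_pdivlMr//; have := expR_ge1Dx (x * c); lra.
Qed.

Lemma green_double_le a t : 0 <= t -> `|green_double a t| <= t * expR (- (a * t / 2)).
Proof.
by move=> t0; rewrite /green_double ger0_norm ?mulr_ge0 ?expR_ge0// !mulNr.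
Qed.

(** The bound [|sin y| <= |y|] cancels the division by [w], so the estimate stays uniform as the
    roots merge. *)
Lemma green_under_le a w t : 0 < w -> 0 <= t ->
  `|green_under a w t| <= t * expR (- (a * t / 2)).
Proof.
move=> w0 t0; rewrite /green_under !normrM normfV gtr0_norm// (gtr0_norm w0).
rewrite (gtr0_norm (expR_gt0 _)) (_ : - a / 2 * t = - (a * t / 2)); last by ring.
rewrite ler_pdivrMr//.
have wt0 : 0 <= w / 2 * t by rewrite mulr_ge0 ?divr_ge0// ltW.
have := normr_sin_le (w / 2 * t); rewrite (ger0_norm wt0).
have := expR_gt0 (- (a * t / 2)); move: (expR _) => E E0 h.
have -> : t * E * w = 2 * (E * (w / 2 * t)) by field.
by rewrite !ler_pM2l.
Qed.

(** Half of the exponential absorbs the linear factor, since [1 + y <= 2 (1 + y/2) <= 2 exp(y/2)].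
    Used with [y = a t / 2], this turns the rate [a/2] into [a/4]. *)
Lemma one_plus_expRN_le (y : R) : 0 <= y ->
  (1 + y) * expR (- y) <= 2 * expR (- (y / 2)).
Proof.
move=> y0; have -> : expR (- y) = expR (- (y / 2)) * expR (- (y / 2)).
  by rewrite -expRD; congr expR; field.
rewrite mulrA ler_pM2r ?expR_gt0// expRN ler_pdivrMr ?expR_gt0//.
have := expR_ge1Dx (y / 2); lra.
Qed.

Lemma green_double_propagator_le a t : 0 <= a -> 0 <= t ->
  `|derive1 (green_double a) t + a * green_double a t|
  <= 2 * expR (- (a * t / 4)).
Proof.
move=> a0 t0; rewrite derive1_green_double /green_double.
have -> : - a * t / 2 = - (a * t / 2) by ring.
have -> : a * t / 4 = a * t / 2 / 2 by field.
have y0 : 0 <= a * t / 2 by rewrite divr_ge0 ?mulr_ge0.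
apply: le_trans (one_plus_expRN_le y0).
rewrite ger0_norm; last first.
  rewrite mulrA -mulrDl mulr_ge0 ?expR_ge0//; lra.
by rewrite mulrA -mulrDl ler_pM2r ?expR_gt0//; lra.
Qed.

Lemma green_under_propagator_le a w t : 0 < w -> 0 <= a -> 0 <= t ->
  `|derive1 (green_under a w) t + a * green_under a w t|
  <= 2 * expR (- (a * t / 4)).
Proof.
move=> w0 a0 t0; rewrite derive1_green_under ?gt_eqF//.
have -> : a * t / 4 = a * t / 2 / 2 by field.
have y0 : 0 <= a * t / 2 by rewrite divr_ge0 ?mulr_ge0.
apply: le_trans (one_plus_expRN_le y0).
have -> : - a / 2 * green_under a w t + expR (- a / 2 * t) * cos (w / 2 * t) +
    a * green_under a w t =
  expR (- (a * t / 2)) * cos (w / 2 * t) + a / 2 * green_under a w t.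
  rewrite (_ : - a / 2 * t = - (a * t / 2)); last by ring.
  by field.
apply: le_trans (ler_normD _ _) _; rewrite mulrDl mul1r; apply: lerD.
  rewrite normrM gtr0_norm ?expR_gt0// ler_piMr ?expR_ge0//.
  by rewrite ler_norml cos_geN1 cos_le1.
rewrite normrM ger0_norm ?divr_ge0//.
apply: le_trans (ler_wpM2l _ (green_under_le a w0 t0)) _; first by rewrite divr_ge0.
by rewrite le_eqVlt; apply/orP; left; apply/eqP; field.
Qed.

(** * Bounds for two distinct real roots *)

Section overdamped.
Variables (a b l t : R).
Hypotheses (ab : 2 * `|b| < a) (l0 : 0 < l) (l2 : l ^+ 2 = a ^+ 2 - 4 * b ^+ 2)
  (t0 : 0 <= t).

Lemma overdamped_gt0 : 0 < a.
Proof. by apply: le_lt_trans ab; rewrite mulr_ge0. Qed.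

Lemma overdamped_le : l <= a.
Proof.
have a0 := overdamped_gt0.
have b20 : 0 <= b ^+ 2 by exact: sqr_ge0.
by rewrite -(@ler_pXn2r _ 2) ?nnegrE ?(ltW l0) ?(ltW a0)// l2; lra.
Qed.

(** The product of the roots is [b^2], so the larger one is [- 2 b^2 / (a + l)], and
    [a + l <= 2 a]. *)
Lemma expR_root_le : expR ((- a + l) / 2 * t) <= expR (- (b ^+ 2 * t / (2 * a))).
Proof.
have a0 := overdamped_gt0; have la := overdamped_le; have l0' := l0; have t0' := t0.
have b20 : 0 <= b ^+ 2 by exact: sqr_ge0.
rewrite ler_expR (_ : - (b ^+ 2 * t / (2 * a)) = - (b ^+ 2 / (2 * a)) * t); last by ring.
apply: ler_wpM2r => //.
have : b ^+ 2 = (a - l) * (a + l) / 4 by rewrite -subr_sqr l2; field.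
move=> ->; rewrite -subr_ge0.
have -> : - ((a - l) * (a + l) / 4 / (2 * a)) - (- a + l) / 2 =
  (a - l) * (3 * a - l) / (8 * a) by field; rewrite gt_eqF.
by rewrite divr_ge0 ?mulr_ge0//; lra.
Qed.

Lemma green_over_ge0 : 0 <= green_over a l t.
Proof.
have a0 := overdamped_gt0; have la := overdamped_le; have l0' := l0; have t0' := t0.
rewrite /green_over divr_ge0 ?(ltW l0)// subr_ge0 ler_expR ler_wpM2r//; lra.
Qed.

Lemma green_over_le : a * green_over a l t <= 8 * expR (- (b ^+ 2 * t / (2 * a))).
Proof.
have a0 := overdamped_gt0; have la := overdamped_le; have l0' := l0; have t0' := t0.
(* For well separated roots [1/l] is at most [2/a]. For close ones division by [l] must be avoided,
   but then both roots lie below [- a/4]. *)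
have [al|al] := leP a (2 * l).
  have : green_over a l t <= expR ((- a + l) / 2 * t) / l.
    by rewrite ler_pM2r ?invr_gt0// gerBl expR_ge0.
  have E0 := expR_gt0 ((- a + l) / 2 * t).
  have := expR_root_le; move: (expR _) E0 => E E0 h g.
  apply: (@le_trans _ _ (a * (E / l))); first by rewrite ler_pM2l.
  apply: (@le_trans _ _ (8 * E)); last by lra.
  rewrite mulrA ler_pdivrMr//; nra.
have g : green_over a l t <= t * expR (- (t * (a / 4))).
  rewrite /green_over ler_pdivrMr//.
  have -> : (- a - l) / 2 * t = (- a + l) / 2 * t + - (l * t) by field.
  rewrite expRD -[X in X - _]mulr1 -mulrBr.
  have e1 : 1 - expR (- (l * t)) <= l * t by have := expR_ge1Dx (- (l * t)); lra.
  have e2 : expR ((- a + l) / 2 * t) <= expR (- (t * (a / 4))).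
    by rewrite ler_expR -subr_ge0 (_ : _ - _ = t * (a - 2 * l) / 4)
      ?divr_ge0 ?mulr_ge0//; [lra|field].
  have -> : t * expR (- (t * (a / 4))) * l = expR (- (t * (a / 4))) * (l * t) by ring.
  apply: ler_pM => //; rewrite ?expR_ge0// subr_ge0 expR_le1.
  by rewrite oppr_le0 mulr_ge0// ltW.
apply: (@le_trans _ _ (a * (t * expR (- (t * (a / 4)))))); first by rewrite ler_pM2l.
(* One half pays for the factor [a * t], at the cost of the constant 8; the other half is below the
   target exponential because [4 b^2 < a^2]. *)
have -> : expR (- (t * (a / 4))) = expR (- (a * t / 8)) * expR (- (a * t / 8)).
  by rewrite -expRD; congr expR; field.
rewrite !mulrA; apply: ler_pM; rewrite ?mulr_ge0 ?expR_ge0 ?(ltW a0)//.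
  have := @mul_expRN_le (a * t) 8^-1; rewrite invrK; apply => //.
  by rewrite mulr_ge0// ltW.
rewrite ler_expR lerN2 -subr_ge0.
have -> : a * t / 8 - b ^+ 2 * t / (2 * a) = t * (a ^+ 2 - 4 * b ^+ 2) / (8 * a).
  by field; rewrite gt_eqF.
by rewrite -l2 divr_ge0 ?mulr_ge0 ?sqr_ge0// ltW.
Qed.

(** The expression equals the mean of the two exponentials plus [(a/2) G]. The mean costs 1 and
    [(a/2) G] costs 4, by [green_over_le]. *)
Lemma green_over_propagator_le : `|derive1 (green_over a l) t + a * green_over a l t|
  <= 5 * expR (- (b ^+ 2 * t / (2 * a))).
Proof.
have a0 := overdamped_gt0; have la := overdamped_le; have l0' := l0; have t0' := t0.
rewrite derive1_green_over.
have -> : ((- a + l) / 2 * expR ((- a + l) / 2 * t) -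
   (- a - l) / 2 * expR ((- a - l) / 2 * t)) / l + a * green_over a l t =
  (expR ((- a + l) / 2 * t) + expR ((- a - l) / 2 * t)) / 2 + a / 2 * green_over a l t.
  by rewrite /green_over; field; rewrite gt_eqF.
have := green_over_le; have := green_over_ge0.
have e1 : expR ((- a - l) / 2 * t) <= expR ((- a + l) / 2 * t).
  rewrite ler_expR ler_wpM2r//; lra.
have := expR_ge0 ((- a - l) / 2 * t); have := expR_root_le.
rewrite ger0_norm; first by lra.
apply: addr_ge0; first by rewrite divr_ge0 ?addr_ge0 ?expR_ge0.
by rewrite mulr_ge0 ?green_over_ge0// divr_ge0// ltW.
Qed.

End overdamped.

End green_function.

Section green_hat.
Context (R : realType) (n : nat) (e1 : 'I_n).
Implicit Types (xi : 'rV[R]_n) (t x y : R).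
Local Notation normc := (@ComplexField.Normc.normc R).

Lemma normc_real x : normc x%:C = `|x|.
Proof. by rewrite /= expr0n/= addr0 sqrtr_sqr. Qed.

Lemma complex_half x y : (x +i* y) / 2 = (x / 2) +i* (y / 2).
Proof.
have two : (2 : R[i]) = 2%:C by rewrite rmorph_nat.
apply: (canLR (mulfK _)); first by rewrite pnatr_eq0.
by rewrite two; simpc; congr (_ +i* _); field.
Qed.

Lemma cexpE x y : cexp (x +i* y) = (expR x * cos y) +i* (expR x * sin y).
Proof. by rewrite /cexp/=; simpc. Qed.

Lemma normsq_ge0 xi : 0 <= normsq xi.
Proof. by apply: sumr_ge0 => i _; rewrite -expr2 sqr_ge0. Qed.

Let D xi : R := normsq xi ^+ 2 - 4 * xi ord0 e1 ^+ 2.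

Definition green_real xi : R -> R :=
  if D xi == 0 then green_double (normsq xi)
  else if 0 < D xi then green_over (normsq xi) (Num.sqrt (D xi))
  else green_under (normsq xi) (Num.sqrt (- D xi)).

(** The roots are real or complex conjugate, so the multiplier is real in every case. *)
Lemma green_hatE xi t : green_hat e1 xi t = (green_real xi t)%:C.
Proof.
rewrite /green_hat /green_real /lambdap /lambdam /lambda0 -/(D xi) sqrtc_eq0.
rewrite (_ : ((D xi)%:C == 0) = (D xi == 0)); last by rewrite eq_complex/= eqxx andbT.
case: eqVneq => [//|D0].
have [Dp|Dn] := ltP 0 (D xi).
  rewrite sqrtc_sqrtr/=; last by rewrite lecE/= eqxx ltW.
  have l0 : Num.sqrt (D xi) != 0 by rewrite gt_eqF ?sqrtr_gt0.
  apply: (canLR (mulfK _)); first by rewrite eq_complex/= (negbTE l0).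
  set a := normsq xi; set l := Num.sqrt _.
  have -> : (- a%:C + l%:C) / 2 * t%:C = ((- a + l) / 2 * t)%:C.
    have -> : - a%:C + l%:C = (- a + l) +i* 0 by simpc.
    by rewrite complex_half mul0r; simpc.
  have -> : (- a%:C - l%:C) / 2 * t%:C = ((- a - l) / 2 * t)%:C.
    have -> : - a%:C - l%:C = (- a - l) +i* 0 by simpc.
    by rewrite complex_half mul0r; simpc.
  rewrite !cexpE cos0 sin0 !mulr0 !mulr1 /green_over; simpc.
  by congr (_ +i* _); field.
have Dm : 0 < - D xi by rewrite oppr_gt0 lt_neqAle D0.
set w := Num.sqrt (- D xi); have w0 : w != 0 by rewrite gt_eqF ?sqrtr_gt0.
(* On negative reals [sqrtc] selects the root on the positive imaginary axis. *)
have -> : sqrtc (D xi)%:C = 0 +i* w.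
  rewrite /= eqxx expr0n/= addr0 sqrtr_sqr ltr0_norm; last by rewrite -oppr_gt0.
  rewrite addNr mul0r sqrtr0 mul1r; congr (_ +i* Num.sqrt _).
  by field.
apply: (canLR (mulfK _)); first by rewrite eq_complex/= (negbTE w0) andbF.
set a := normsq xi.
have -> : (- a%:C + (0 +i* w)) / 2 * t%:C = (- a / 2 * t) +i* (w / 2 * t).
  have -> : - a%:C + (0 +i* w) = (- a) +i* w by simpc.
  by rewrite complex_half; simpc.
have -> : (- a%:C - (0 +i* w)) / 2 * t%:C = (- a / 2 * t) +i* (- (w / 2 * t)).
  have -> : - a%:C - (0 +i* w) = (- a) +i* (- w) by simpc.
  by rewrite complex_half (mulNr w); simpc.
rewrite !cexpE cosN sinN /green_under; simpc.
by congr (_ +i* _); field.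
Qed.

Lemma cderive1_green_hat xi t :
  cderive1 (green_hat e1 xi) t = (derive1 (green_real xi) t)%:C.
Proof.
rewrite /cderive1; congr (_ +i* _).
  by congr (derive1 _ t); apply/funext => s; rewrite green_hatE.
rewrite (_ : (fun s => _) = cst 0) ?derive1_cst//.
by apply/funext => s; rewrite green_hatE.
Qed.

(** It adds the moduli of the multipliers of both data, so a single integral estimate serves [u0]
    and [u1]. *)
Definition green_kernel xi t : R :=
  normc (cderive1 (green_hat e1 xi) t + (normsq xi)%:C * green_hat e1 xi t) +
  normc (green_hat e1 xi t).

Lemma green_kernelE xi t : green_kernel xi t =
  `|derive1 (green_real xi) t + normsq xi * green_real xi t| + `|green_real xi t|.
Proof.
rewrite /green_kernel cderive1_green_hat green_hatE -rmorphM -rmorphD.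
by rewrite !normc_real.
Qed.

Lemma green_kernel_ge0 xi t : 0 <= green_kernel xi t.
Proof. by rewrite green_kernelE addr_ge0. Qed.

Lemma green_kernel_under xi t : 0 <= t -> normsq xi <= 2 * `|xi ord0 e1| ->
  green_kernel xi t <= (2 + t) * expR (- (normsq xi * t / 4)).
Proof.
move=> t0 ab; rewrite green_kernelE; have a0 := normsq_ge0 xi.
have DN : D xi <= 0.
  rewrite /D subr_le0 -(real_normK (num_real (xi ord0 e1))).
  have -> : 4 * `|xi ord0 e1| ^+ 2 = (2 * `|xi ord0 e1|) ^+ 2 by ring.
  by rewrite lerXn2r ?nnegrE ?mulr_ge0.
have e24 : expR (- (normsq xi * t / 2)) <= expR (- (normsq xi * t / 4)).
  rewrite ler_expR lerN2 ler_wpM2l ?mulr_ge0// lef_pV2 ?posrE//; lra.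
rewrite mulrDl /green_real ltNge DN /=; case: eqVneq => D0; apply: lerD.
- exact: green_double_propagator_le.
- by apply: le_trans (green_double_le _ t0) _; rewrite ler_wpM2l.
- apply: green_under_propagator_le => //.
  by rewrite sqrtr_gt0 oppr_gt0 lt_neqAle D0.
- apply: le_trans (green_under_le _ _ t0) _; rewrite ?ler_wpM2l//.
  by rewrite sqrtr_gt0 oppr_gt0 lt_neqAle D0.
Qed.

Lemma green_kernel_over xi t : 0 <= t -> 2 * `|xi ord0 e1| < normsq xi ->
  green_kernel xi t <= (5 + 8 / normsq xi) *
                 expR (- (xi ord0 e1 ^+ 2 * t / (2 * normsq xi))).
Proof.
move=> t0 ab; rewrite green_kernelE; have a0 : 0 < normsq xi.
  by apply: le_lt_trans ab; rewrite mulr_ge0.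
have Dp : 0 < D xi.
  rewrite /D subr_gt0 -(real_normK (num_real (xi ord0 e1))).
  have -> : 4 * `|xi ord0 e1| ^+ 2 = (2 * `|xi ord0 e1|) ^+ 2 by ring.
  by rewrite ltrXn2r ?nnegrE ?mulr_ge0// ltW.
have l2 : Num.sqrt (D xi) ^+ 2 = normsq xi ^+ 2 - 4 * xi ord0 e1 ^+ 2.
  by rewrite sqr_sqrtr// ltW.
have l0 : 0 < Num.sqrt (D xi) by rewrite sqrtr_gt0.
rewrite /green_real gt_eqF// Dp mulrDl; apply: lerD.
  exact: (green_over_propagator_le ab l0 l2 t0).
rewrite ger0_norm ?(green_over_ge0 ab l0 l2 t0)//.
rewrite mulrAC ler_pdivlMr// mulrC.
exact: (green_over_le ab l0 l2 t0).
Qed.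

End green_hat.

(** * The kernel integral *)

Section kernel_integral.
Context (R : realType).

Lemma normsq_recl m (x : 'rV[R]_m.+1) :
  normsq x = x ord0 ord0 ^+ 2 + normsq (uncons_rV x).2.
Proof.
rewrite /normsq /dotv big_ord_recl -expr2; congr (_ + _).
by apply: eq_bigr => i _; rewrite /= mxE.
Qed.

Lemma supn_uncons_le m (x : 'rV[R]_m.+1) : supn (uncons_rV x).2 <= supn x.
Proof.
by apply: bigmax_le => [|i _]; [exact: supn_ge0 | rewrite /= mxE; exact: le_supn].
Qed.

Lemma supn_sq_le m (x : 'rV[R]_m) : supn x ^+ 2 <= normsq x.
Proof.
case: m x => [|m] x.
  by rewrite /supn big_ord0 expr0n normsq_ge0.
have [i ->] := supn_eq ord0 x.
rewrite real_normK ?num_real// /normsq /dotv (bigD1 i)//= -expr2 lerDl.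
by apply: sumr_ge0 => j _; rewrite -expr2 sqr_ge0.
Qed.

Lemma normsq_le_supn m (x : 'rV[R]_m) : normsq x <= m%:R * supn x ^+ 2.
Proof.
rewrite mulr_natl -[m in _ *+ m]card_ord -sumr_const; apply: ler_sum => i _.
by rewrite -expr2 -real_normK ?num_real// lerXn2r ?nnegrE ?supn_ge0// le_supn.
Qed.

(** Raise [y <= exp y] at [y = x/k] to the power [k]. *)
Lemma expr_le_expR (k : nat) (x : R) : 0 <= x -> x ^+ k <= k%:R ^+ k * expR x.
Proof.
case: k => [|k] x0; first by rewrite !expr0 mul1r -expR0 ler_expR.
have y0 : 0 <= x / k.+1%:R by rewrite divr_ge0.
have -> : x = k.+1%:R * (x / k.+1%:R) by rewrite mulrC divfK.
move: (x / k.+1%:R) y0 => y y0.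
rewrite expRM_natl exprMn ler_pM2l ?exprn_gt0//.
rewrite lerXn2r ?nnegrE ?expR_ge0//.
have := expR_ge1Dx y; lra.
Qed.

Lemma gauss_le_pow (k : nat) (y : R) : 1 <= y ->
  expR (- (y ^+ 2 / 4)) <= (4 * k%:R) ^+ k * y ^- k.
Proof.
move=> y1; have y0 : 0 < y by lra.
rewrite expRN ler_pdivlMr ?exprn_gt0// -ler_pdivlMl ?invr_gt0 ?expR_gt0// invrK.
have := @expr_le_expR k (y ^+ 2 / 4).
rewrite expr_div_n ler_pdivrMr ?exprn_gt0// => /(_ _); rewrite divr_ge0 ?sqr_ge0// => h.
apply: (@le_trans _ _ ((y ^+ 2) ^+ k)); last first.
  by apply: le_trans (h isT) _; rewrite exprMn le_eqVlt; apply/orP; left; apply/eqP; ring.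
rewrite lerXn2r ?nnegrE ?sqr_ge0 ?(ltW y0)// expr2 ler_peMr//; lra.
Qed.

(** The decay that [m+1] integrable derivatives give a Fourier transform on an [m]-dimensional
    space. *)
Definition weight m (x : 'rV[R]_m) : R := (1 + supn x ^+ m.+1)^-1.

Lemma weight_gt0 m (x : 'rV[R]_m) : 0 < weight x.
Proof. by rewrite invr_gt0 ltr_wpDr// exprn_ge0// supn_ge0. Qed.

Lemma weight_le1 m (x : 'rV[R]_m) : weight x <= 1.
Proof. by rewrite invf_le1 ?lerDl ?ltr_wpDr// ?exprn_ge0// ?supn_ge0. Qed.

Lemma weight_le_pow m (x : 'rV[R]_m) (r : R) : 0 < r -> r <= supn x ->
  weight x <= r ^- m.+1.
Proof.
move=> r0 rx; rewrite lef_pV2 ?posrE ?exprn_gt0//; last first.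
  by rewrite ltr_wpDr// exprn_ge0// supn_ge0.
have : r ^+ m.+1 <= supn x ^+ m.+1 by rewrite lerXn2r ?nnegrE ?supn_ge0 ?(ltW r0).
lra.
Qed.

Lemma upint_le_weight m : upint_le (lebesgue_rV R m) (@weight m) (2 * 4 ^+ m).
Proof.
have := @upint_le_radial R m 1 (@weight m) ltr01.
rewrite expr1n divr1; apply; first exact: weight_le1.
move=> x; rewrite mul1r => x1; apply: weight_le_pow => //; lra.
Qed.

Lemma upint_le_gauss m : exists2 C : R, 0 <= C & forall t : R, 0 < t ->
  upint_le (lebesgue_rV R m) (fun x => expR (- (normsq x * t / 4)))
    (C / Num.sqrt t ^+ m).
Proof.
(* The constant of [gauss_le_pow] at [k = m+1]; dividing by it gives the normalisation that
   [upint_le_radial] asks for. *)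
set N : R := (4 * m.+1%:R) ^+ m.+1.
have N1 : 1 <= N by rewrite exprn_ege1// -natrM ler1n muln_gt0.
have N0 : 0 < N by lra.
exists (N * (2 * 4 ^+ m)); first by rewrite !mulr_ge0 ?exprn_ge0// ltW.
move=> t t0; have s0 : 0 < Num.sqrt t by rewrite sqrtr_gt0.
have h (x : 'rV[R]_m) : expR (- (normsq x * t / 4)) <=
    expR (- ((Num.sqrt t * supn x) ^+ 2 / 4)).
  rewrite ler_expR lerN2 exprMn sqr_sqrtr ?(ltW t0)// (mulrC t).
  by apply: ler_wpM2r => //; apply: ler_wpM2r; rewrite ?(ltW t0) ?supn_sq_le.
have := @upint_le_radial R m (Num.sqrt t)
  (fun x => N^-1 * expR (- (normsq x * t / 4))) s0.
have e1 (x : 'rV[R]_m) : N^-1 * expR (- (normsq x * t / 4)) <= 1.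
  rewrite ler_pdivrMl// mulr1; apply: le_trans N1; rewrite expR_le1 oppr_le0.
  by rewrite divr_ge0// mulr_ge0 ?normsq_ge0 ?(ltW t0).
have e2 (x : 'rV[R]_m) : 1 <= Num.sqrt t * supn x ->
    N^-1 * expR (- (normsq x * t / 4)) <= (Num.sqrt t * supn x) ^- m.+1.
  move=> y1; rewrite ler_pdivrMl//; apply: le_trans (h x) _.
  exact: gauss_le_pow.
move=> /(_ e1 e2)/(upint_leZ (ltW N0)); rewrite !mulrA.
by apply: upint_le_mono => x; rewrite mulrA divff ?gt_eqF ?mul1r.
Qed.

(** For [t <= 1] the Gaussian is dropped, the weight is integrable and [1 / sqrt t >= 1]. For
    [t > 1] the weight is dropped instead. *)
Lemma upint_le_kernel_under m : (3 <= m)%N -> exists2 C : R, 0 <= C &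
  forall t : R, 0 < t -> upint_le (lebesgue_rV R m)
    (fun x => (2 + t) * expR (- (normsq x * t / 4)) * weight x) (C / Num.sqrt t).
Proof.
move=> m3; have [C C0 HC] := upint_le_gauss m.
exists (3 * (2 * 4 ^+ m) + 3 * C).
  by rewrite addr_ge0 ?mulr_ge0 ?exprn_ge0.
move=> t t0; set s := Num.sqrt t; have s0 : 0 < s by rewrite sqrtr_gt0.
have s2 : s ^+ 2 = t by rewrite sqr_sqrtr// ltW.
have ex (x : 'rV[R]_m) : expR (- (normsq x * t / 4)) <= 1 :> R.
  by rewrite expR_le1 oppr_le0 divr_ge0// mulr_ge0 ?normsq_ge0 ?(ltW t0).
have [t1|t1] := leP t 1.
  have s1 : s <= 1 by rewrite -(@ler_pXn2r _ 2) ?nnegrE ?(ltW s0)// s2 expr1n.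
  apply: upint_le_bound; last first.
    apply: upint_le_mono; last exact: (upint_leZ (ler0n _ 3) (upint_le_weight m)).
    move=> x /=; rewrite ler_wpM2r ?(ltW (weight_gt0 _))//.
    have := ex x; have := expR_ge0 (- (normsq x * t / 4)); nra.
  rewrite ler_pdivlMr//; apply: (@le_trans _ _ (3 * (2 * 4 ^+ m))).
    by rewrite ler_piMr ?mulr_ge0 ?exprn_ge0.
  by rewrite lerDl mulr_ge0.
apply: upint_le_bound; last first.
  apply: upint_le_mono; last exact: (upint_leZ (mulr_ge0 (ler0n _ 3) (ltW t0)) (HC t t0)).
  move=> x /=; have := weight_le1 x; have := weight_gt0 x.
  have := expR_ge0 (- (normsq x * t / 4)); move: (expR _) (weight x) => E w E0 w0 w1.
  apply: (@le_trans _ _ ((2 + t) * E)).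
    by rewrite ler_piMr ?mulr_ge0//; lra.
  by rewrite ler_wpM2r//; lra.
have s1 : 1 <= s by rewrite -(@ler_pXn2r _ 2) ?nnegrE ?(ltW s0)// s2 expr1n ltW.
have s3 : s ^+ 3 <= s ^+ m by rewrite ler_weXn2l.
apply: (@le_trans _ _ (3 * C / s)); last first.
  by rewrite ler_pM2r ?invr_gt0// lerDr !mulr_ge0 ?exprn_ge0.
rewrite -/s -s2 ler_pdivlMr//.
have -> : 3 * s ^+ 2 * (C / s ^+ m) * s = 3 * C * (s ^+ 3 / s ^+ m) by ring.
by rewrite ler_piMr ?mulr_ge0// ler_pdivrMr ?exprn_gt0// mul1r.
Qed.

Lemma upint_le_kernel m : (2 <= m)%N -> exists2 C : R, 0 <= C &
  forall t : R, 0 < t -> upint_le (lebesgue_rV R m.+1)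
    (fun x => green_kernel ord0 x t * weight x) (C / Num.sqrt t).
Proof.
move=> m2; have [C1 C10 H1] := @upint_le_kernel_under m.+1 m2.
have [C3 C30 H3] := @upint_le_conic R m m2.
have m0 : 0 < m%:R :> R by rewrite ltr0n; case: (m) m2.
exists (C1 + 13 * (2 * 4 ^+ m.+1) + 8 * C3).
  by rewrite !addr_ge0 ?mulr_ge0 ?exprn_ge0.
move=> t t0; set s := Num.sqrt t; have s0 : 0 < s by rewrite sqrtr_gt0.
have s2 : s ^+ 2 = t by rewrite sqr_sqrtr// ltW.
pose F (x : 'rV[R]_m.+1) := green_kernel ord0 x t * weight x.
have F0 x : 0 <= F x by rewrite mulr_ge0 ?green_kernel_ge0// ltW ?weight_gt0.
pose cone (x : 'rV[R]_m.+1) := (2 * `|x ord0 ord0| < normsq x) &&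
  (x ord0 ord0 ^+ 2 <= normsq (uncons_rV x).2).
(* The division by 8 fits the kernel to the constant-free bound of [upint_le_conic]: on the cone
   [5 + 8/a <= 8 (1 + r^-2)], since [a >= r^2]. *)
pose F3 x := if cone x then F x / 8 else 0.
have F30 x : 0 <= F3 x by rewrite /F3; case: ifP => // _; rewrite divr_ge0.
have U2 : upint_le (lebesgue_rV R m.+1) (fun x => 13 / s * weight x)
    (13 / s * (2 * 4 ^+ m.+1)).
  by apply: upint_leZ (upint_le_weight _); rewrite divr_ge0// ltW.
have U3 : upint_le (lebesgue_rV R m.+1) (fun x => 8 * F3 x) (8 * (C3 / s)).
  apply: upint_leZ => //; apply: H3 => // x; set r := supn _; rewrite /F3.
  case: ifPn => [/andP[xa xs]|_]; last by left.
  right; move: xa xs; set b := x ord0 ord0.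
  have aE := normsq_recl x; rewrite -/b in aE.
  have b0 : 0 <= b ^+ 2 by exact: sqr_ge0.
  have rs := supn_sq_le (uncons_rV x).2; have sr := normsq_le_supn (uncons_rV x).2.
  rewrite -/r in rs sr => xa xs.
  have a0 : 0 < normsq x by apply: le_lt_trans xa; rewrite mulr_ge0.
  have s'0 : 0 < normsq (uncons_rV x).2 by lra.
  have r0 : 0 < r.
    rewrite lt_neqAle supn_ge0 andbT eq_sym; apply/eqP => r0.
    by move: sr; rewrite r0 expr0n mulr0; lra.
  have r20 : 0 < r ^+ 2 by rewrite exprn_gt0.
  set K := _ * (1 + r ^- 2).
  have kK : green_kernel ord0 x t / 8 <= K.
    rewrite ler_pdivrMr// /K.
    apply: le_trans (green_kernel_over (ltW t0) xa) _; rewrite (mulrC (5 + _)) -[X in _ <= X]mulrA.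
    apply: ler_pM; rewrite ?expR_ge0 ?addr_ge0 ?divr_ge0 ?normsq_ge0//.
      rewrite ler_expR lerN2 -/b; apply: ler_wpM2l; first by rewrite mulr_ge0// ltW.
      rewrite lef_pV2 ?posrE ?mulr_gt0//.
      have -> : 4 * m%:R * r ^+ 2 = 4 * (m%:R * r ^+ 2) by ring.
      lra.
    have : (normsq x)^-1 <= r ^- 2 by rewrite lef_pV2 ?posrE//; lra.
    lra.
  have K0 : 0 <= K by apply: le_trans kK; rewrite divr_ge0 ?green_kernel_ge0.
  have -> : F x / 8 = green_kernel ord0 x t / 8 * weight x by rewrite /F; ring.
  have w0 := weight_gt0 x; split => //.
    apply: le_trans kK; rewrite ler_piMr ?weight_le1// divr_ge0 ?green_kernel_ge0//.
  apply: ler_pM => //; rewrite ?divr_ge0 ?green_kernel_ge0 ?(ltW w0)//.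
  by apply: weight_le_pow => //; exact: supn_uncons_le.
apply: upint_le_bound; last first.
  apply: upint_le_mono; last first.
    exact: (upint_leD (upint_leD (H1 t t0) U2) U3).
  move=> x /=; rewrite -/(F x).
  have w0 := weight_gt0 x; have F3x := F30 x.
  have n1 : 0 <= (2 + t) * expR (- (normsq x * t / 4)) * weight x.
    by rewrite !mulr_ge0 ?expR_ge0 ?(ltW w0)//; lra.
  have n2 : 0 <= 13 / s * weight x by rewrite mulr_ge0 ?divr_ge0 ?(ltW w0) ?(ltW s0).
  have [ab|ba] := leP (normsq x) (2 * `|x ord0 ord0|).
    have : F x <= (2 + t) * expR (- (normsq x * t / 4)) * weight x.
      by rewrite ler_pM2r//; apply: green_kernel_under => //; exact: ltW.
    lra.
  have [bs|sb] := leP (x ord0 ord0 ^+ 2) (normsq (uncons_rV x).2).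
    have : F3 x = F x / 8 by rewrite /F3 /cone ba bs.
    lra.
  suff : F x <= 13 / s * weight x by lra.
  rewrite ler_pM2r//; apply: le_trans (green_kernel_over (ltW t0) ba) _.
  have aE := normsq_recl x; have s'0 := normsq_ge0 (uncons_rV x).2.
  move: aE ba sb; set a := normsq x; set b := x ord0 ord0 => aE ba sb.
  have b2 : b ^+ 2 = `|b| ^+ 2 by rewrite real_normK ?num_real.
  have b0 : 0 < `|b|.
    rewrite lt_neqAle normr_ge0 andbT eq_sym; apply/eqP => b0.
    by move: sb; rewrite b2 b0 expr0n/=; lra.
  (* Here [2 |b| < a < 2 b^2]. So [a] stays away from 0, and [5 + 8/a] is at most 13. *)
  have b1 : 1 <= `|b| by nra.
  have a1 : 1 <= a by nra.
  have E : expR (- (b ^+ 2 * t / (2 * a))) <= s^-1.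
    rewrite expRN lef_pV2 ?posrE ?expR_gt0//.
    have h : t / 4 <= b ^+ 2 * t / (2 * a).
      rewrite ler_pdivlMr ?mulr_gt0//; last by lra.
      have -> : t / 4 * (2 * a) = (a / 2) * t by field.
      rewrite ler_pM2r//; lra.
    (* From [(s - 2)^2 >= 0], so that [exp(t/4) >= 1 + t/4] bounds [s = sqrt t]. *)
    have st : s <= 1 + t / 4.
      have := sqr_ge0 (s - 2); rewrite -s2 sqrrB; lra.
    move: (b ^+ 2 * t / (2 * a)) h => Y h; have := expR_ge1Dx Y; lra.
  apply: ler_pM => //; rewrite ?expR_ge0//.
    by rewrite addr_ge0// divr_ge0//; lra.
  suff : 8 / a <= 8 by lra.
  by rewrite ler_pdivrMr; lra.
by rewrite le_eqVlt; apply/orP; left; apply/eqP; ring.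
Qed.

End kernel_integral.

(** * A smooth bump and test functions *)

Section bounded_smooth.
Context (R : realType).
Implicit Types (f : R -> R) (P : {poly R}).

Definition bsmooth f := forall k : nat,
  (forall x, derivable (derive1n k f) x 1) /\
  exists B, forall x, `|derive1n k f x| <= B.

Lemma bsmooth_derivable f x : bsmooth f -> derivable f x 1.
Proof. by move=> /(_ 0%N) [+ _]; exact. Qed.

Lemma bsmooth_bounded f : bsmooth f -> exists B, forall x, `|f x| <= B.
Proof. by move=> /(_ 0%N) []. Qed.

Lemma bsmooth_derive1 f : bsmooth f -> bsmooth (derive1 f).
Proof. by move=> sf k; rewrite -derive1Sn; exact: sf. Qed.

Lemma bsmooth_cos : bsmooth cos.
Proof.
move=> k.
have -> : derive1n k (@cos R) = (fun y => cos (y + pi / 2 *+ k)).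
  elim: k => [|k IH]; first by apply/funext => y; rewrite mulr0n addr0.
  rewrite derive1nS IH; apply/funext => y; rewrite derive1E.
  have h : is_derive y 1 (fun z : R => z + pi / 2 *+ k) 1.
    by apply: is_derive_eq; rewrite addr0.
  have -> : cos (y + pi / 2 *+ k.+1) = - sin (y + pi / 2 *+ k) * 1.
    by rewrite mulr1 mulrSr addrA cosDpihalf.
  exact: (@derive_val _ _ _ _ _ _ _ (@is_derive1_comp_eq _ cos _ _ _ _ _ _ h erefl)).
split=> [x|].
  have h : is_derive x 1 (fun z : R => z + pi / 2 *+ k) 1.
    by apply: is_derive_eq; rewrite addr0.
  exact: (@ex_derive _ _ _ _ _ _ _ (@is_derive1_comp_eq _ cos _ _ _ _ _ _ h erefl)).
by exists 1 => x; rewrite ler_norml cos_geN1 cos_le1.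
Qed.

(* P(1/y) exp(-1/y), extended by 0: a family closed under differentiation. *)
Definition flat P (y : R) : R := if 0 < y then P.[y^-1] * expR (- y^-1) else 0.

Lemma flat_ge0 y : 0 <= flat 1 y.
Proof. by rewrite /flat; case: ifP => // _; rewrite hornerC mul1r expR_ge0. Qed.

Lemma flat_le1 y : flat 1 y <= 1.
Proof.
rewrite /flat; case: ifP => // y0; rewrite hornerC mul1r expR_le1.
by rewrite oppr_le0 invr_ge0 ltW.
Qed.

(** At [z = 1/y], each monomial satisfies [z^i exp(-z) <= i^i]. *)
Lemma flat_bounded P : exists2 B, 0 <= B & forall y, `|flat P y| <= B.
Proof.
exists (\sum_(i < size P) `|P`_i| * i%:R ^+ i).
  by apply: sumr_ge0 => i _; rewrite mulr_ge0 ?exprn_ge0.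
move=> y; rewrite /flat; case: ifP => [y0|_]; last first.
  by rewrite normr0; apply: sumr_ge0 => i _; rewrite mulr_ge0 ?exprn_ge0.
rewrite normrM (gtr0_norm (expR_gt0 _)) expRN ler_pdivrMr ?expR_gt0//.
rewrite horner_coef mulr_suml; apply: le_trans (ler_norm_sum _ _ _) _.
apply: ler_sum => i _; rewrite normrM -mulrA ler_wpM2l// ger0_norm.
  by apply: expr_le_expR; rewrite invr_ge0 ltW.
by rewrite exprn_ge0 ?invr_ge0 ?ltW.
Qed.

Lemma is_derive_flat P (y : R) :
  is_derive y 1 (flat P) (flat ((P - P^`()) * 'X^2) y).
Proof.
have [y0|y0|<-] := ltgtP 0 y.
- rewrite [X in is_derive _ _ _ X]/flat y0.
  apply: (@near_eq_is_derive R R^o R^o (fun z => P.[z^-1] * expR (- z^-1))).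
    by near=> z; rewrite /flat ifT//; near: z; exact: lt_nbhsr.
  have dV : is_derive y 1 (fun z : R => z^-1) (- y ^- 2).
    have := @is_deriveV R id y 1 1 (lt0r_neq0 y0) (is_derive_id _ _).
    by rewrite /GRing.scale/= mulr1.
  have dE : is_derive y 1 (fun z : R => expR (- z^-1)) (expR (- y^-1) * y ^- 2).
    have -> : (fun z : R => expR (- z^-1)) = (fun z => expR (-1 * z^-1)).
      by apply/funext => z; rewrite mulN1r.
    apply: (@is_derive1_comp_eq _ (fun u => expR (-1 * u)) (fun z : R => z^-1)
      _ _ _ _ (is_derive_expRM _ _) dV).
    by rewrite !mulN1r; ring.
  have dP : is_derive y 1 (fun z : R => P.[z^-1]) (P^`().[y^-1] * - y ^- 2).
    exact: (@is_derive1_comp_eq _ (horner P) (fun z : R => z^-1) _ _ _ _ _ dV erefl).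
  apply: is_derive1M dP dE _.
  by rewrite hornerM hornerD hornerN hornerXn exprVn; ring.
- rewrite [X in is_derive _ _ _ X]/flat ltNge (ltW y0)/=.
  apply: (@near_eq_is_derive R R^o R^o (cst 0)).
  near=> z; rewrite /flat/= ifF//; apply/negbTE; rewrite -leNgt ltW//.
  by near: z; exact: lt_nbhsl.
rewrite [X in is_derive _ _ _ X]/flat ltxx.
(* At the origin the difference quotient is [flat P h / h = h * flat (P * 'X^2) h], hence at most
   [B |h|] in modulus. *)
have [B B0 HB] := flat_bounded (P * 'X^2).
have lim0 : h^-1 *: ((flat P \o shift 0) (h *: 1) - flat P 0) @[h --> 0^'] --> (0 : R).
  apply/norm_cvg0P.
  apply: (@squeeze_cvgr _ _ _ _ (cst 0) (fun h => B * `|h|)).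
  - near=> h; rewrite normr_ge0/= /shift/= addr0 /flat ltxx subr0 normrM.
    rewrite /GRing.scale/= mulr1; case: ifP => h0; last first.
      by rewrite normr0 mulr0 mulr_ge0.
    have := HB h; rewrite /flat h0 hornerM hornerXn => Bh.
    apply: le_trans (ler_wpM2r (normr_ge0 h) Bh).
    rewrite -!normrM le_eqVlt; apply/orP; left; apply/eqP; congr `|_|.
    by field; rewrite gt_eqF.
  - exact: cvg_cst.
  - have B1 : 0 < B + 1 by lra.
    apply/cvgr0Pnorm_le => e e0; near=> h.
    have : `|h| <= e / (B + 1).
      by near: h; apply: dnbhs0_le; rewrite divr_gt0.
    rewrite ler_pdivlMr// normrM normr_id (ger0_norm B0).
    by have := normr_ge0 h; lra.
apply: DeriveDef; first by apply/cvg_ex; exists 0.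
exact: cvg_lim lim0.
Unshelve. all: by end_near. Qed.

Lemma bsmooth_flat P : bsmooth (flat P).
Proof.
move=> k; have [Q ->] : exists Q, derive1n k (flat P) = flat Q.
  elim: k => [|k [Q IH]]; first by exists P.
  exists ((Q - Q^`()) * 'X^2); rewrite derive1nS IH; apply/funext => y.
  by rewrite derive1E; apply: derive_val; exact: is_derive_flat.
split=> [x|]; first by apply: ex_derive; exact: is_derive_flat.
by have [B _ HB] := flat_bounded Q; exists B.
Qed.

End bounded_smooth.

Section ridge_functions.
Context (R : realType) (n : nat).
Implicit Types (phi psi : 'rV[R]_n -> R) (x v : 'rV[R]_n).

(** A syntactic class containing the cutoffs and cosines and stable under partial derivatives, so
    that differentiability and measurability of all derivatives follow by induction on its terms. *)
Inductive ridge : ('rV[R]_n -> R) -> Prop :=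
| ridge_fun (f : R -> R) v (c d : R) : bsmooth f ->
    ridge (fun x => c * f (dotv x v + d))
| ridgeD phi psi : ridge phi -> ridge psi -> ridge (fun x => phi x + psi x)
| ridgeM phi psi : ridge phi -> ridge psi -> ridge (fun x => phi x * psi x).

Lemma differentiable_dotv v x : differentiable (fun y => dotv y v : R) x.
Proof.
have -> : (fun y => dotv y v : R) = \sum_i (fun y : 'rV[R]_n => v ord0 i *: (y ord0 i : R)).
  by apply/funext => y; rewrite fct_sumE; apply: eq_bigr => i _; rewrite /GRing.scale/= mulrC.
apply: differentiable_sum => i; apply: differentiableZ.
exact: differentiable_coord.
Qed.

Lemma measurable_dotv v : measurable_fun [set: 'rV[R]_n] (fun y => dotv y v : R).
Proof.
apply: measurable_sum => i; apply: measurable_funM => //.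
exact: measurable_coord.
Qed.

Lemma dotvD x y v : dotv (x + y) v = dotv x v + dotv y v.
Proof. by rewrite -big_split; apply: eq_bigr => i _; rewrite mxE mulrDl. Qed.

Lemma dotvZl (c : R) x v : dotv (c *: x) v = c * dotv x v.
Proof. by rewrite mulr_sumr; apply: eq_bigr => i _; rewrite mxE mulrA. Qed.

Lemma dotvZr (c : R) x v : dotv x (c *: v) = c * dotv x v.
Proof. by rewrite mulr_sumr; apply: eq_bigr => i _; rewrite mxE mulrCA. Qed.

Lemma dotv_deltal i v : dotv (delta_mx ord0 i) v = v ord0 i.
Proof.
rewrite /dotv (bigD1 i)//= big1 ?addr0 => [|j ji]; rewrite mxE eqxx/=.
  by rewrite eqxx mul1r.
by rewrite (negbTE ji) mul0r.
Qed.

Lemma dotv_deltar i x : dotv x (delta_mx ord0 i) = x ord0 i.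
Proof.
rewrite /dotv (bigD1 i)//= big1 ?addr0 => [|j ji]; rewrite mxE eqxx/=.
  by rewrite eqxx mulr1.
by rewrite (negbTE ji) mulr0.
Qed.

Lemma ridge_differentiable phi x : ridge phi -> differentiable phi x.
Proof.
elim=> [f v c d sf|{}phi psi _ IH1 _ IH2|{}phi psi _ IH1 _ IH2].
- apply: (@differentiableZ _ _ _ (fun x => f (dotv x v + d)) c).
  apply: (@differentiable_comp _ _ _ _ (fun x => dotv x v + d) f).
    by apply: differentiableD; [exact: differentiable_dotv|exact: differentiable_cst].
  by apply/derivable1_diffP; exact: bsmooth_derivable.
- exact: differentiableD.
- exact: differentiableM.
Qed.

Lemma ridge_measurable phi : ridge phi -> measurable_fun [set: 'rV[R]_n] phi.
Proof.
elim=> [f v c d sf|{}phi psi _ IH1 _ IH2|{}phi psi _ IH1 _ IH2].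
- apply: measurable_funM => //.
  apply: (@measurableT_comp _ _ _ _ _ _ f).
    apply: continuous_measurable_fun => y; apply: differentiable_continuous.
    by apply/derivable1_diffP; exact: bsmooth_derivable.
  by apply: measurable_funD => //; exact: measurable_dotv.
- exact: measurable_funD.
- exact: measurable_funM.
Qed.

Lemma partial_ridge_fun i (f : R -> R) v (c d : R) : bsmooth f ->
  partial i (fun x => c * f (dotv x v + d)) =
  (fun x => (c * v ord0 i) * derive1 f (dotv x v + d)).
Proof.
move=> sf; apply/funext => x; rewrite /partial.
set e := delta_mx _ _.
have -> : 'D_e (fun x => c * f (dotv x v + d)) x =
    'D_1 (fun h : R => c * f (v ord0 i * h + (dotv x v + d))) 0.
  rewrite /derive [X in lim (X @ _) = _](_ : _ = (fun h : R => h^-1 *: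
    (((fun h : R => c * f (v ord0 i * h + (dotv x v + d))) \o shift 0) (h *: 1) -
     c * f (v ord0 i * 0 + (dotv x v + d)))))//.
  apply/funext => h.
  rewrite /= /shift/= dotvD dotvZl dotv_deltal /GRing.scale/= !addr0 mulr1 mulr0 add0r.
  by rewrite (mulrC h (v _ _)) -!addrA.
set k := dotv x v + d.
have H1 : is_derive (0 : R) 1 (fun h : R => v ord0 i * h + k) (v ord0 i).
  have := @is_deriveD R R^o R^o _ _ (0 : R^o) 1 _ _ (is_derive1_scale (v ord0 i) 0)
    (is_derive_cst (k : R^o) (0 : R^o) 1).
  by rewrite addr0.
have H2 : is_derive (v ord0 i * 0 + k) 1 f (derive1 f k).
  rewrite mulr0 add0r derive1E; apply: DeriveDef => //; exact: bsmooth_derivable.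
have H3 : is_derive (0 : R) 1 (fun h : R => f (v ord0 i * h + k)) (derive1 f k * v ord0 i).
  exact: (@is_derive1_comp_eq R f (fun h => v ord0 i * h + k) 0 _ _ _ H2 H1 erefl).
have H4 : is_derive (0 : R) 1 (fun h : R => c * f (v ord0 i * h + k))
    (c * v ord0 i * derive1 f k).
  apply: (is_derive1M (is_derive_cst (c : R^o) (0 : R^o) 1) H3).
  by rewrite mulr0 addr0 /cst mulrA mulrAC.
exact: derive_val.
Qed.

Lemma partialD i phi psi : ridge phi -> ridge psi ->
  partial i (fun x => phi x + psi x) = (fun x => partial i phi x + partial i psi x).
Proof.
move=> rp rs; apply/funext => x; rewrite /partial.
by rewrite -deriveD//; apply: diff_derivable; exact: ridge_differentiable.
Qed.

Lemma partialM i phi psi : ridge phi -> ridge psi ->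
  partial i (fun x => phi x * psi x) =
  (fun x => partial i phi x * psi x + phi x * partial i psi x).
Proof.
move=> rp rs; apply/funext => x; rewrite /partial.
have -> : 'D_(delta_mx ord0 i) (fun x => phi x * psi x) x =
    phi x *: 'D_(delta_mx ord0 i) psi x + psi x *: 'D_(delta_mx ord0 i) phi x.
  by apply: deriveM; apply: diff_derivable; exact: ridge_differentiable.
by rewrite /GRing.scale/= addrC (mulrC (psi x)).
Qed.

Lemma ridge_partial i phi : ridge phi -> ridge (partial i phi).
Proof.
elim=> [f v c d sf|{}phi psi r1 IH1 r2 IH2|{}phi psi r1 IH1 r2 IH2].
- by rewrite partial_ridge_fun//; apply: ridge_fun; exact: bsmooth_derive1.
- by rewrite partialD//; exact: ridgeD.
- by rewrite partialM//; apply: ridgeD; exact: ridgeM.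
Qed.

Lemma ridge_smooth phi : ridge phi -> smooth phi.
Proof.
move=> rp s x; apply: ridge_differentiable.
by elim: s => //= i s IH; exact: ridge_partial.
Qed.

Lemma partials_nseqSr k i phi :
  partials (nseq k.+1 i) phi = partials (nseq k i) (partial i phi).
Proof. by elim: k phi => [//|k IH] phi; rewrite /= -IH. Qed.

Lemma multi_partial_pure k i phi :
  multi_partial (fun j => if j == i then k else 0%N) phi = partials (nseq k i) phi.
Proof.
rewrite /multi_partial; congr partials.
set s := flatten _.
have /all_pred1P -> : all (pred1 i) s.
  apply/allP => j /flatten_mapP[l _]; rewrite mem_nseq.
  by case: eqP => [->|_]; rewrite ?ltnn//= => /andP[_ /eqP ->] /=; rewrite eqxx.
congr nseq; rewrite size_flatten /shape -map_comp sumnE big_map big_enum/=.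
rewrite (bigD1 i)//= size_nseq eqxx big1 ?addn0// => j ji.
by rewrite size_nseq (negbTE ji).
Qed.

End ridge_functions.

Section bounded_pointwise_limits.
Context (R : realType) (n : nat) (i : 'I_n).
Implicit Types (F : nat -> 'rV[R]_n -> R) (G : 'rV[R]_n -> R).

(** Bounded pointwise convergence of the pure [i]-derivatives up to order [k]: exactly what
    dominated convergence consumes, and stable under the Leibniz rule. *)
Fixpoint bpcvg k F G : Prop :=
  [/\ forall N, ridge (F N), ridge G, exists B, forall N x, `|F N x| <= B &
      forall x, F N x @[N --> \oo] --> G x] /\
  if k is k'.+1 then bpcvg k' (fun N => partial i (F N)) (partial i G) else True.

Lemma bpcvg_base k F G : bpcvg k F G ->
  [/\ forall N, ridge (F N), ridge G, exists B, forall N x, `|F N x| <= B &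
      forall x, F N x @[N --> \oo] --> G x].
Proof. by case: k => [|k] []. Qed.

Lemma bpcvgS k F G : bpcvg k.+1 F G -> bpcvg k F G.
Proof.
elim: k F G => [|k IH] F G [H1 H2]; split => //; exact: IH.
Qed.

Lemma bpcvgD k F G F' G' : bpcvg k F G -> bpcvg k F' G' ->
  bpcvg k (fun N x => F N x + F' N x) (fun x => G x + G' x).
Proof.
elim: k F G F' G' => [|k IH] F G F' G' H H'.
  have [r1 r2 [B HB] c] := bpcvg_base H; have [r1' r2' [B' HB'] c'] := bpcvg_base H'.
  split => //; split => [N||| x]; [exact: ridgeD|exact: ridgeD| |exact: cvgD].
  by exists (B + B') => N x; apply: le_trans (ler_normD _ _) _; exact: lerD.
have [r1 r2 [B HB] c] := bpcvg_base H; have [r1' r2' [B' HB'] c'] := bpcvg_base H'.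
split.
  split => [N||| x]; [exact: ridgeD|exact: ridgeD| |exact: cvgD].
  by exists (B + B') => N x; apply: le_trans (ler_normD _ _) _; exact: lerD.
rewrite partialD// (_ : (fun N => _) = (fun N x => partial i (F N) x + partial i (F' N) x)).
  by case: H H' => [_ H] [_ H']; exact: IH.
by apply/funext => N; rewrite partialD.
Qed.

Lemma bpcvgM k F G F' G' : bpcvg k F G -> bpcvg k F' G' ->
  bpcvg k (fun N x => F N x * F' N x) (fun x => G x * G' x).
Proof.
have base F1 G1 F1' G1' k1 : bpcvg k1 F1 G1 -> bpcvg k1 F1' G1' ->
  [/\ forall N, ridge (fun x => F1 N x * F1' N x), ridge (fun x => G1 x * G1' x),
   exists B, forall N x, `|F1 N x * F1' N x| <= B &
      forall x, F1 N x * F1' N x @[N --> \oo] --> G1 x * G1' x].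
  move=> H H'.
  have [r1 r2 [B HB] c] := bpcvg_base H; have [r1' r2' [B' HB'] c'] := bpcvg_base H'.
  split => [N||| x]; [exact: ridgeM|exact: ridgeM| |exact: cvgM].
  by exists (B * B') => N x; rewrite normrM; exact: ler_pM.
elim: k F G F' G' => [|k IH] F G F' G' H H'; split => //; try exact: (base _ _ _ _ _ H H').
have [r1 r2 _ _] := bpcvg_base H; have [r1' r2' _ _] := bpcvg_base H'.
rewrite partialM// (_ : (fun N => _) = (fun N x => partial i (F N) x * F' N x +
    F N x * partial i (F' N) x)); last by apply/funext => N; rewrite partialM.
apply: bpcvgD; apply: IH; try exact: bpcvgS; by [case: H|case: H'].
Qed.

(** Each derivative moves a factor [e N * v_i] into the coefficient, so the induction needs [c] to
    vary with [N]. With [e0 = 0] the limit is constant in [x]. *)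
Lemma bpcvg_ridge_fun k (f : R -> R) v (d : R) (c e : nat -> R) (c0 e0 : R) :
  bsmooth f -> c @ \oo --> c0 -> e @ \oo --> e0 ->
  bpcvg k (fun N x => c N * f (dotv x (e N *: v) + d))
          (fun x => c0 * f (dotv x (e0 *: v) + d)).
Proof.
have base (g : R -> R) (a : nat -> R) (a0 : R) : bsmooth g ->
    a @ \oo --> a0 -> e @ \oo --> e0 ->
  [/\ forall N, ridge (fun x => a N * g (dotv x (e N *: v) + d)),
   ridge (fun x => a0 * g (dotv x (e0 *: v) + d)),
   exists B, forall N x, `|a N * g (dotv x (e N *: v) + d)| <= B &
   forall x, a N * g (dotv x (e N *: v) + d) @[N --> \oo] -->
     a0 * g (dotv x (e0 *: v) + d)].
  move=> sg ca ce; split => [N||| x]; [exact: ridge_fun|exact: ridge_fun| |].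
    have [A HA] : exists A, forall N, `|a N| <= A.
      have [A [_ HA]] := cvg_seq_bounded (cvgP _ ca).
      by exists (A + 1) => N; apply: HA => //; rewrite ltrDl.
    have [B HB] := bsmooth_bounded sg.
    by exists (A * B) => N x; rewrite normrM; exact: ler_pM.
  apply: cvgM => //; apply: continuous_cvg.
    by apply: differentiable_continuous; apply/derivable1_diffP; exact: bsmooth_derivable.
  apply: cvgD; last exact: cvg_cst.
  rewrite dotvZr; under eq_fun do rewrite dotvZr.
  by apply: cvgM => //; exact: cvg_cst.
elim: k f c c0 => [|k IH] f c c0 sf cc ce; split => //; try exact: base.
rewrite partial_ridge_fun// (_ : (fun N => _) = (fun N x => (c N * (e N *: v) ord0 i) *
  derive1 f (dotv x (e N *: v) + d))); last first.
  by apply/funext => N; rewrite partial_ridge_fun.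
apply: (IH (derive1 f) (fun N => c N * (e N *: v) ord0 i)) => //; first exact: bsmooth_derive1.
rewrite mxE; under eq_fun do rewrite mxE.
by apply: cvgM => //; apply: cvgM => //; exact: cvg_cst.
Qed.

Lemma bpcvg_prod k (I : Type) (s : seq I) (F : I -> nat -> 'rV[R]_n -> R)
    (G : I -> 'rV[R]_n -> R) :
  (forall j, bpcvg k (F j) (G j)) ->
  bpcvg k (fun N x => \prod_(j <- s) F j N x) (fun x => \prod_(j <- s) G j x).
Proof.
move=> H; elim: s => [|j s IH].
  (* The empty product 1 is presented as a cosine so that it has the form of a ridge function. *)
  have E x : 1 * cos (dotv x (0 *: (0 : 'rV[R]_n)) + 0) = 1 :> R.
    by rewrite dotvZr mul0r addr0 cos0 mulr1.
  have -> : (fun (N : nat) x => \prod_(j <- [::]) F j N x) =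
      (fun N x => 1 * cos (dotv x (0 *: 0) + 0)).
    by apply/funext => N; apply/funext => x; rewrite big_nil E.
  have -> : (fun x => \prod_(j <- [::]) G j x) =
      (fun x => 1 * cos (dotv x (0 *: 0) + 0)).
    by apply/funext => x; rewrite big_nil E.
  by apply: (@bpcvg_ridge_fun _ cos 0 0 (fun=> 1) (fun=> 0));
    [exact: bsmooth_cos|exact: cvg_cst|exact: cvg_cst].
have -> : (fun N x => \prod_(j <- j :: s) F j N x) =
    (fun N x => F j N x * \prod_(j <- s) F j N x).
  by apply/funext => N; apply/funext => x; rewrite big_cons.
have -> : (fun x => \prod_(j <- j :: s) G j x) =
    (fun x => G j x * \prod_(j <- s) G j x).
  by apply/funext => x; rewrite big_cons.
exact: bpcvgM.
Qed.

Lemma bpcvg_partials k F G : bpcvg k F G ->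
  [/\ forall N, ridge (partials (nseq k i) (F N)), ridge (partials (nseq k i) G),
   exists B, forall N x, `|partials (nseq k i) (F N) x| <= B &
      forall x, partials (nseq k i) (F N) x @[N --> \oo] --> partials (nseq k i) G x].
Proof.
elim: k F G => [|k IH] F G H; first exact: (bpcvg_base H).
case: H => _ /IH[h1 h2 [B HB] h4]; split => [N||| x].
- by rewrite partials_nseqSr.
- by rewrite partials_nseqSr.
- by exists B => N x; rewrite partials_nseqSr.
- rewrite partials_nseqSr (_ : (fun N => _) =
    (fun N => partials (nseq k i) (partial i (F N)) x)); first exact: h4.
  by apply/funext => N; rewrite partials_nseqSr.
Qed.

End bounded_pointwise_limits.

Section cutoff.
Context (R : realType) (n : nat).

(** The factors at [1 + x_i/(N+1)] and [1 - x_i/(N+1)] vanish together outside [|x_i| < N+1]. The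
    [1 *] matches the shape of [ridge_fun]. *)
Definition cutoff (N : nat) (x : 'rV[R]_n) : R :=
  \prod_i ((1 * flat 1 (dotv x (N.+1%:R^-1 *: delta_mx ord0 i) + 1)) *
           (1 * flat 1 (dotv x (- N.+1%:R^-1 *: delta_mx ord0 i) + 1))).

(** This is [exp(-2n)]. The cutoffs are not normalised to tend to 1; only positivity of the limit
    matters, and it is divided out at the end. *)
Definition cutoff_lim : R := \prod_(i < n) (flat 1 1 * flat 1 1).

Lemma cutoff_lim_gt0 : 0 < cutoff_lim.
Proof.
by apply: prodr_gt0 => i _; rewrite mulr_gt0// /flat ltr01 hornerC mul1r expR_gt0.
Qed.

Lemma bpcvg_cutoff i k : bpcvg i k cutoff (fun=> cutoff_lim).
Proof.
have := @bpcvg_prod R n i k _ (index_enum 'I_n)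
  (fun j N x => (1 * flat 1 (dotv x (N.+1%:R^-1 *: delta_mx ord0 j) + 1)) *
           (1 * flat 1 (dotv x (- N.+1%:R^-1 *: delta_mx ord0 j) + 1)))
  (fun j x => (1 * flat 1 (dotv x (0 *: delta_mx ord0 j) + 1)) *
           (1 * flat 1 (dotv x (0 *: delta_mx ord0 j) + 1))).
have -> : (fun x : 'rV[R]_n => \prod_(j <- index_enum 'I_n)
    ((1 * flat 1 (dotv x (0 *: delta_mx ord0 j) + 1)) *
           (1 * flat 1 (dotv x (0 *: delta_mx ord0 j) + 1)))) = (fun=> cutoff_lim).
  by apply/funext => x; apply: eq_bigr => j _; rewrite dotvZr !mul0r add0r !mul1r.
apply => j; apply: bpcvgM.
  apply: (@bpcvg_ridge_fun _ _ _ _ (flat 1) _ 1 (fun=> 1) (fun N => N.+1%:R^-1)).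
  - exact: bsmooth_flat.
  - exact: cvg_cst.
  - exact: cvg_harmonic.
apply: (@bpcvg_ridge_fun _ _ _ _ (flat 1) _ 1 (fun=> 1) (fun N => - N.+1%:R^-1)).
- exact: bsmooth_flat.
- exact: cvg_cst.
- by rewrite -[X in _ --> X]oppr0; apply: cvgN; exact: cvg_harmonic.
Qed.

Lemma cutoff_norm_le1 N x : `|cutoff N x| <= 1.
Proof.
rewrite normr_prod -[leRHS](@big1 R _ *%R _ (index_enum 'I_n) xpredT (fun=> 1))//.
apply: ler_prod => j _; rewrite normr_ge0/= !mul1r ger0_norm ?mulr_ge0 ?flat_ge0//.
by rewrite mulr_ile1 ?flat_ge0 ?flat_le1.
Qed.

Lemma cutoff_support N x : cutoff N x != 0 -> cube N.+1%:R x.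
Proof.
move=> c0 j; rewrite ler_norml leNgt leNgt -negb_or; apply: contra c0 => h.
rewrite /cutoff (bigD1 j)//= !mul1r !dotvZr dotv_deltar.
have N0 : 0 < N.+1%:R :> R by rewrite ltr0n.
have [h1|h1] := orP h.
  rewrite [flat _ _]/flat ifF ?mul0r//; apply/negbTE; rewrite -leNgt.
  rewrite -lerBrDr sub0r mulrC ler_pdivrMr// mulN1r; exact: ltW.
rewrite [X in _ * X * _]/flat ifF ?(mulr0, mul0r)//; apply/negbTE; rewrite -leNgt.
by rewrite -lerBrDr sub0r mulNr lerN2 mulrC ler_pdivlMr// mul1r ltW.
Qed.

Lemma compact_closure_sub_cube (A : set 'rV[R]_n) (r : R) : 0 <= r ->
  A `<=` cube r -> compact (closure A).
Proof.
move=> r0 Ar.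
have cl : closed [set x : 'rV[R]_n | `|x| <= r].
  apply: (@closed_comp _ _ (fun x : 'rV[R]_n => `|x|) [set y : R | y <= r]).
    by move=> x _; exact: norm_continuous.
  exact: closed_le.
have sub : closure A `<=` [set x : 'rV[R]_n | `|x| <= r].
  rewrite closureE => x; apply; split => // y /Ar yr.
  rewrite /= [`|y|]/Num.Def.normr/= mx_normrE; apply: bigmax_le => //= ij _.
  by have := yr ij.2; rewrite (ord1 ij.1).
apply: bounded_closed_compact; last exact: closed_closure.
exists r; split; first exact: num_real.
by move=> M rM x /sub /= xr; apply: le_trans xr (ltW rM).
Qed.

End cutoff.

(** * Decay of the Fourier transform *)

Section weak_derivative_bound.
Context (R : realType) (n : nat).
Local Notation mu := (lebesgue_rV R n).

Lemma normr_cvg_le (u : nat -> R) (l B : R) :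
  u @ \oo --> l -> (forall N, `|u N| <= B) -> `|l| <= B.
Proof.
move=> ul uB; have c : `|u N| @[N --> \oo] --> `|l| by exact: cvg_norm.
rewrite -(cvg_lim (@Rhausdorff R) c).
by apply: limr_le; [exact: cvgP c|exact: nearW].
Qed.

Lemma partials_cos k i (c d : R) (xi : 'rV[R]_n) :
  partials (nseq k i) (fun x => c * cos (dotv x xi + d)) =
  (fun x => (c * xi ord0 i ^+ k) * cos (dotv x xi + (d + pi / 2 *+ k))).
Proof.
elim: k c d => [|k IH] c d.
  by apply/funext => x; rewrite expr0 mulr1 mulr0n addr0.
rewrite partials_nseqSr partial_ridge_fun; last exact: bsmooth_cos.
have -> : (fun x => c * xi ord0 i * derive1 cos (dotv x xi + d)) =
    (fun x => c * xi ord0 i * cos (dotv x xi + (d + pi / 2))).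
  apply/funext => x; rewrite addrA cosDpihalf derive1E; congr (_ * _).
  exact: derive_val.
rewrite IH; apply/funext => x; congr (_ * cos (_ + _)); first by rewrite exprS mulrA.
by rewrite [pi / 2 *+ k.+1]mulrS !addrA.
Qed.

Lemma integrable_mul_bounded (p h : 'rV[R]_n -> R) (B : R) :
  mu.-integrable setT (EFin \o p) -> measurable_fun [set: 'rV[R]_n] h ->
  (forall x, `|h x| <= B) ->
  mu.-integrable setT (EFin \o (fun x => p x * h x)).
Proof.
move=> ip mh hB; have mp : measurable_fun [set: 'rV[R]_n] p.
  by apply/measurable_EFinP; exact: measurable_int ip.
apply: (@le_integrable _ _ _ _ _ measurableT _ (EFin \o (fun x => B * p x))).
- by apply/measurable_EFinP; exact: measurable_funM.
- move=> x _; rewrite lee_fin !normrM mulrC ler_wpM2r//.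
  by apply: le_trans (hB x) _; exact: ler_norm.
- rewrite (_ : EFin \o _ = (fun x => B%:E * (p x)%:E)%E); last exact/funext.
  exact: integrableZl.
Qed.

(** Only the side carrying [p] passes to the limit, by dominated convergence; the side carrying [q]
    is bounded uniformly because the test functions are at most 1 in modulus. *)
Lemma weak_derivative_cos_bound (p q : 'rV[R]_n -> R) k i (Q : R) :
  mu.-integrable setT (EFin \o p) -> mu.-integrable setT (EFin \o q) ->
  (forall phi, test_function phi ->
    \int[mu]_x (p x * partials (nseq k i) phi x) =
    (-1) ^+ k * \int[mu]_x (q x * phi x)) ->
  (\int[mu]_x (`|q x|)%:E <= Q%:E)%E ->
  forall (xi : 'rV[R]_n) (d : R),
  cutoff_lim R n * (`|xi ord0 i| ^+ k * `|\int[mu]_x (p x * cos (dotv x xi + d))|) <= Q.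
Proof.
move=> ip iq pq qQ xi d0.
(* Each derivative of the cosine advances the phase by [pi / 2], so starting from here [k]
   derivatives arrive at [d0]. *)
set d := d0 - pi / 2 *+ k.
pose phi N (x : 'rV[R]_n) : R := cutoff N x * (1 * cos (dotv x (1 *: xi) + d)).
pose plim (x : 'rV[R]_n) : R := cutoff_lim R n * (1 * cos (dotv x (1 *: xi) + d)).
have limE : partials (nseq k i) plim =
    (fun x => (cutoff_lim R n * xi ord0 i ^+ k) * cos (dotv x xi + d0)).
  have -> : plim = (fun x => cutoff_lim R n * cos (dotv x xi + d)).
    by apply/funext => x; rewrite /plim mul1r scale1r.
  by rewrite partials_cos /d subrK.
have bp : bpcvg i k phi plim.
  apply: bpcvgM; first exact: bpcvg_cutoff.
  by apply: bpcvg_ridge_fun; [exact: bsmooth_cos|exact: cvg_cst|exact: cvg_cst].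
have [rphi _ _ _] := bpcvg_base bp.
have tphi N : test_function (phi N).
  split; first exact: ridge_smooth.
  apply: (@compact_closure_sub_cube _ _ _ N.+1%:R) => // x /= h.
  apply: cutoff_support; apply: contra h => /eqP c0.
  by rewrite /phi c0 mul0r.
have phi1 N x : `|phi N x| <= 1.
  rewrite normrM mulr_ile1 ?cutoff_norm_le1// mul1r.
  by rewrite ler_norml cos_geN1 cos_le1.
have [r1 r2 [B HB] cv] := bpcvg_partials bp.
have mp : measurable_fun [set: 'rV[R]_n] p.
  by apply/measurable_EFinP; exact: measurable_int ip.
have mq : measurable_fun [set: 'rV[R]_n] q.
  by apply/measurable_EFinP; exact: measurable_int iq.
have B0 : 0 <= B by apply: le_trans (HB 0%N 0).
have bound N : `|\int[mu]_x (p x * partials (nseq k i) (phi N) x)| <= Q.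
  rewrite pq// normrM normrX normrN normr1 expr1n mul1r.
  apply: Rintegral_upint; exists (fun x => `|q x|%:E); split => //.
  - by apply/measurable_EFinP; exact: measurableT_comp.
  - by move=> x; rewrite lee_fin normrM ler_piMr.
have ccvg : \int[mu]_x (p x * partials (nseq k i) (phi N) x) @[N --> \oo] -->
    \int[mu]_x (p x * partials (nseq k i) plim x).
  have mlim : measurable_fun [set: 'rV[R]_n] (partials (nseq k i) plim).
    exact: ridge_measurable.
  have limB x : `|partials (nseq k i) plim x| <= B.
    exact: normr_cvg_le (cv x) (HB ^~ x).
  have ilim := integrable_mul_bounded ip mlim limB.
  rewrite /Rintegral; apply: fine_cvg.
  rewrite fineK; last exact: integrable_fin_num.
  apply: (@dominated_cvg _ _ _ mu setT measurableT
    (fun N x => (p x * partials (nseq k i) (phi N) x)%:E)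
    (fun x => (p x * partials (nseq k i) plim x)%:E)
    (fun x => (B%:E * `|(p x)%:E|)%E)) => //.
  - move=> N; apply/measurable_EFinP; apply: measurable_funM => //.
    exact: ridge_measurable.
  - move=> x _; apply: cvg_EFin; first by apply: nearW.
    by apply: cvgM => //; exact: cvg_cst.
  - by apply: integrableZl => //; exact: integrable_abse.
  - move=> N x _; rewrite lee_fin normrM mulrC ler_wpM2r//.
have : `|\int[mu]_x (p x * partials (nseq k i) plim x)| <= Q.
  exact: normr_cvg_le ccvg bound.
rewrite limE.
have -> : \int[mu]_x (p x * (cutoff_lim R n * xi ord0 i ^+ k * cos (dotv x xi + d0))) =
    cutoff_lim R n * xi ord0 i ^+ k * \int[mu]_x (p x * cos (dotv x xi + d0)).
  rewrite -RintegralZl//; last first.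
    apply: (@integrable_mul_bounded _ _ 1) => //.
      apply: (@ridge_measurable _ _ (fun x => cos (dotv x xi + d0))).
      have := @ridge_fun R n cos xi 1 d0 (@bsmooth_cos R).
      by under eq_fun do rewrite mul1r.
    by move=> x; rewrite ler_norml cos_geN1 cos_le1.
  by apply: eq_Rintegral => x _; ring.
rewrite !normrM normrX -mulrA; apply: le_trans.
by rewrite ler_wpM2r ?mulr_ge0 ?exprn_ge0// ler_norm.
Qed.

End weak_derivative_bound.

Section fourier_decay.
Context (R : realType) (n : nat).
Local Notation mu := (lebesgue_rV R n).
Local Notation normc := (@ComplexField.Normc.normc R).
Implicit Types (u v : 'rV[R]_n -> R[i]) (xi : 'rV[R]_n).

Lemma normc_ge0 (z : R[i]) : 0 <= normc z.
Proof. by case: z => a b; exact: sqrtr_ge0. Qed.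

Lemma normr_Re_le (z : R[i]) : `|complex.Re z| <= normc z.
Proof. by case: z => a b /=; rewrite -sqrtr_sqr ler_wsqrtr// lerDl sqr_ge0. Qed.

Lemma normr_Im_le (z : R[i]) : `|complex.Im z| <= normc z.
Proof. by case: z => a b /=; rewrite -sqrtr_sqr ler_wsqrtr// lerDr sqr_ge0. Qed.

Lemma normc_le_ReIm (z : R[i]) : normc z <= `|complex.Re z| + `|complex.Im z|.
Proof.
case: z => a b /=; rewrite -[leRHS]ger0_norm ?addr_ge0// -sqrtr_sqr ler_wsqrtr//.
rewrite sqrrD !real_normK ?num_real// -addrA lerD2l lerDr.
by rewrite mulrn_wge0// mulr_ge0.
Qed.

Lemma cLnorm1E u : cLnorm 1 u = (\int[mu]_x (normc (u x))%:E)%E.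
Proof.
rewrite /cLnorm Lnorm1; apply: eq_integral => x _.
by rewrite gee0_abs// lee_fin normc_ge0.
Qed.

Lemma measurable_normc u : cmeasurable u ->
  measurable_fun [set: 'rV[R]_n] (fun x => normc (u x)).
Proof.
move=> [mr mi].
rewrite (_ : (fun x => _) =
  (fun x => Num.sqrt (complex.Re (u x) ^+ 2 + complex.Im (u x) ^+ 2))).
  have ms : measurable_fun [set: R] (Num.sqrt : R -> R).
    by apply: continuous_measurable_fun; exact: sqrt_continuous.
  apply: (measurableT_comp ms).
  by apply: measurable_funD; apply: measurable_funX.
by apply/funext => x; case: (u x).
Qed.

Lemma integrable_ReIm u : cLfun 1 u ->
  mu.-integrable setT (EFin \o (fun x => complex.Re (u x))) /\
  mu.-integrable setT (EFin \o (fun x => complex.Im (u x))).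
Proof.
move=> [mu_ fu]; have [mr mi] := mu_.
have iu : mu.-integrable setT (EFin \o (fun x => normc (u x))).
  apply/integrableP; split; first by apply/measurable_EFinP; exact: measurable_normc.
  by move: fu; rewrite /cLnorm Lnorm1.
split; apply: le_integrable iu => //; try exact/measurable_EFinP.
  by move=> x _; rewrite lee_fin (ger0_norm (normc_ge0 _)) normr_Re_le.
by move=> x _; rewrite lee_fin (ger0_norm (normc_ge0 _)) normr_Im_le.
Qed.

Lemma weak_derivative_ReIm k i u v phi :
  is_weak_derivative (fun j => if j == i then k else 0%N) u v ->
  test_function phi ->
  \int[mu]_x (complex.Re (u x) * partials (nseq k i) phi x) =
    (-1) ^+ k * \int[mu]_x (complex.Re (v x) * phi x) /\
  \int[mu]_x (complex.Im (u x) * partials (nseq k i) phi x) =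
    (-1) ^+ k * \int[mu]_x (complex.Im (v x) * phi x).
Proof.
move=> [_ _ /[apply]]; rewrite multi_partial_pure.
rewrite (bigD1 i)//= eqxx big1 ?addn0; last by move=> j /negbTE ->.
have E w psi : cintegral (fun x => w x * (psi x)%:C) =
    (\int[mu]_x (complex.Re (w x) * psi x)) +i* (\int[mu]_x (complex.Im (w x) * psi x)).
  rewrite /cintegral; congr (_ +i* _); apply: eq_Rintegral => x _.
    by case: (w x) => a b; simpc.
  by case: (w x) => a b; simpc.
have -> : (-1) ^+ k = ((-1) ^+ k)%:C :> R[i] by rewrite rmorphXn rmorphN1.
by rewrite !E; simpc => -[].
Qed.

(** Since [- sin y = cos (y + pi/2)], only cosine integrals of real functions occur, the form
    treated by [weak_derivative_cos_bound]. *)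
Lemma fourierE u xi : fourier u xi =
  (\int[mu]_x (complex.Re (u x) * cos (dotv x xi + 0) -
               complex.Im (u x) * cos (dotv x xi + pi / 2))) +i*
  (\int[mu]_x (complex.Im (u x) * cos (dotv x xi + 0) +
               complex.Re (u x) * cos (dotv x xi + pi / 2))).
Proof.
rewrite /fourier /cintegral; congr (_ +i* _); apply: eq_Rintegral => x _;
rewrite cexpE expR0 !mul1r cosN sinN addr0 cosDpihalf; case: (u x) => a b; simpc.
  by rewrite /=; ring.
by rewrite /=; ring.
Qed.

Lemma integrable_mul_cos (p : 'rV[R]_n -> R) xi (d : R) :
  mu.-integrable setT (EFin \o p) ->
  mu.-integrable setT (EFin \o (fun x => p x * cos (dotv x xi + d))).
Proof.
move=> ip; apply: (@integrable_mul_bounded _ _ _ _ 1) => //.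
  apply: (@ridge_measurable _ _ (fun x => cos (dotv x xi + d))).
  have := @ridge_fun R n cos xi 1 d (@bsmooth_cos R).
  by under eq_fun do rewrite mul1r.
by move=> x; rewrite ler_norml cos_geN1 cos_le1.
Qed.

(** The factor 4 counts the cosine integrals: real and imaginary part of [u], phases 0 and
    [pi/2]. *)
Lemma fourier_pure_decay k i u v (Q : R) xi : cLfun 1 u -> cLfun 1 v ->
  is_weak_derivative (fun j => if j == i then k else 0%N) u v ->
  (cLnorm 1 v <= Q%:E)%E ->
  cutoff_lim R n * (`|xi ord0 i| ^+ k * normc (fourier u xi)) <= 4 * Q.
Proof.
move=> fu fv uv vQ.
have [ur ui] := integrable_ReIm fu; have [vr vi] := integrable_ReIm fv.
have [[mvr mvi] _] := fv.
have leQ (w : R[i] -> R) : measurable_fun [set: 'rV[R]_n] (w \o v) ->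
    (forall z, `|w z| <= normc z) -> (\int[mu]_x (`|w (v x)|)%:E <= Q%:E)%E.
  move=> mw wn; apply: le_trans vQ; rewrite cLnorm1E; apply: ge0_le_integral => //.
  - by apply/measurable_EFinP; exact: measurableT_comp.
  - by apply/measurable_EFinP; apply: measurable_normc; case: fv.
  - by move=> x _; rewrite lee_fin.
have HRe := @weak_derivative_cos_bound _ _ _ _ k i Q ur vr
  (fun phi t => (weak_derivative_ReIm uv t).1) (leQ _ mvr normr_Re_le) xi.
have HIm := @weak_derivative_cos_bound _ _ _ _ k i Q ui vi
  (fun phi t => (weak_derivative_ReIm uv t).2) (leQ _ mvi normr_Im_le) xi.
have c0 := cutoff_lim_gt0 R n.
set K := cutoff_lim R n * `|xi ord0 i| ^+ k.
have K0 : 0 <= K by rewrite mulr_ge0 ?exprn_ge0// ltW.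
rewrite mulrA -/K; apply: le_trans (ler_wpM2l K0 (normc_le_ReIm _)) _.
rewrite fourierE/= RintegralB ?RintegralD//; try exact: integrable_mul_cos.
have := HRe 0; have := HRe (pi / 2); have := HIm 0; have := HIm (pi / 2).
rewrite !mulrA -/K => h1 h2 h3 h4.
apply: le_trans (ler_wpM2l K0 (lerD (ler_normB _ _) (ler_normD _ _))) _.
rewrite !mulrDr; lra.
Qed.

Lemma cLnorm_fin_num u : cLfun 1 u -> cLnorm 1 u \is a fin_num.
Proof.
move=> [_ fu]; rewrite ge0_fin_numE// cLnorm1E; apply: integral_ge0 => x _.
by rewrite lee_fin normc_ge0.
Qed.

Lemma cLnorm1_ge0 u : (0 <= cLnorm 1 u)%E.
Proof. by rewrite cLnorm1E; apply: integral_ge0 => x _; rewrite lee_fin normc_ge0. Qed.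

Lemma sobolev_norm_fin_num m u : sobolev m 1 u -> sobolev_norm m 1 u \is a fin_num.
Proof.
move=> [_ su]; rewrite /sobolev_norm; apply/sum_fin_numP => a _ am.
by apply: cLnorm_fin_num; have [] := su (fun i => a i) am.
Qed.

Lemma cLnorm_le_sobolev_norm m u k i : (k <= m)%N ->
  (cLnorm 1 (weak_derivative (fun j => if j == i then k else 0%N) u)
   <= sobolev_norm m 1 u)%E.
Proof.
move=> km; pose a : {ffun 'I_n -> 'I_m.+1} :=
  [ffun j => if j == i then inord k else ord0].
have aE : (fun j => if j == i then k else 0%N) = (fun j => a j : nat).
  by apply/funext => j; rewrite ffunE; case: ifP => // _; rewrite inordK.
rewrite aE /sobolev_norm (bigD1 a)/=.
  by rewrite leeDl// sume_ge0// => b _; exact: cLnorm1_ge0.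
rewrite -(eq_bigr _ (fun j _ => congr1 (@^~ j) aE)).
by rewrite (bigD1 i)//= eqxx big1 ?addn0// => j /negbTE ->.
Qed.

Lemma fourier_decay (i0 : 'I_n) u xi : sobolev n.+1 1 u ->
  cutoff_lim R n * normc (fourier u xi) <=
  8 * fine (sobolev_norm n.+1 1 u) * weight xi.
Proof.
move=> su; have [fu wu] := su.
have fW := sobolev_norm_fin_num su; set W := fine _.
have dec k i : (k <= n.+1)%N ->
    cutoff_lim R n * (`|xi ord0 i| ^+ k * normc (fourier u xi)) <= 4 * W.
  move=> kn; pose a j := if j == i then k else 0%N.
  have an : (\sum_j a j <= n.+1)%N.
    by rewrite (bigD1 i)//= /a eqxx big1 ?addn0// => j /negbTE ->.
  have [wd fv] := wu a an.
  apply: (fourier_pure_decay _ fu fv wd).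
  by rewrite fineK//; exact: cLnorm_le_sobolev_norm.
rewrite /weight ler_pdivlMr; last by rewrite ltr_wpDr// exprn_ge0// supn_ge0.
have [i ->] := supn_eq i0 xi.
(* Orders 0 and [n+1] in the coordinate attaining the maximum add up to [8 = 4 + 4]. Order 0 also
   goes through [dec], since [sobolev_norm] measures the chosen [weak_derivative] of order 0 and not
   [u] itself. *)
have := dec 0%N i isT; have := dec n.+1 i (leqnn _); rewrite expr0 mul1r.
move: (normc _) (`|_| ^+ _) => f x; lra.
Qed.

End fourier_decay.

Section solution_bound.
Context (R : realType) (n : nat).
Local Notation normc := (@ComplexField.Normc.normc R).

Lemma cLnorm_infty_le (f : 'rV[R]_n -> R[i]) (M : R) : 0 <= M ->
  (forall x, normc (f x) <= M) -> (cLnorm +oo f <= M%:E)%E.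
Proof.
move=> M0 fM; rewrite /cLnorm unlock; case: ifP => // _.
apply/ess_supP; apply: aeW => x /=.
by rewrite lee_fin ger0_norm ?normc_ge0.
Qed.

Lemma normc_cexpi (y : R) : normc (cexp (0 +i* y)) = 1.
Proof. by rewrite cexpE expR0 !mul1r /= cos2Dsin2 sqrtr1. Qed.

(** The exponential has modulus 1; the 2 comes from bounding real and imaginary parts separately. *)
Lemma inverse_fourier_le (f : 'rV[R]_n -> R[i]) (M : R) x :
  upint_le (lebesgue_rV R n) (fun xi => normc (f xi)) M ->
  normc (inverse_fourier f x) <= (2 * pi) ^- n * (2 * M).
Proof.
move=> H; rewrite /inverse_fourier ComplexField.Normc.normcM normc_real ger0_norm; last first.
  by rewrite invr_ge0 exprn_ge0// mulr_ge0// pi_ge0.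
apply: ler_wpM2l; first by rewrite invr_ge0 exprn_ge0// mulr_ge0// pi_ge0.
have nE xi : normc (cexp (0 +i* dotv x xi) * f xi) = normc (f xi).
  by rewrite ComplexField.Normc.normcM normc_cexpi mul1r.
apply: le_trans (normc_le_ReIm _) _; rewrite mulr_natl mulr2n /=; apply: lerD.
  apply: Rintegral_upint; apply: upint_le_mono H => xi.
  by rewrite -nE normr_Re_le.
apply: Rintegral_upint; apply: upint_le_mono H => xi.
by rewrite -nE normr_Im_le.
Qed.

End solution_bound.

Lemma normc_solution_hat_le (R : realType) (m : nat) (u0 u1 : 'rV[R]_m.+1 -> R[i])
    (t : R) (xi : 'rV[R]_m.+1) :
  sobolev m.+2 1 u0 -> sobolev m.+2 1 u1 ->
  ComplexField.Normc.normc (solution_hat ord0 u0 u1 t xi) <=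
  8 / cutoff_lim R m.+1 *
    (fine (sobolev_norm m.+2 1 u0) + fine (sobolev_norm m.+2 1 u1)) *
    (green_kernel ord0 xi t * weight xi).
Proof.
move=> s0 s1; have c0 := cutoff_lim_gt0 R m.+1.
have W0 : 0 <= fine (sobolev_norm m.+2 1 u0).
  by apply: fine_ge0; apply: sume_ge0 => a _; exact: cLnorm1_ge0.
have W1 : 0 <= fine (sobolev_norm m.+2 1 u1).
  by apply: fine_ge0; apply: sume_ge0 => a _; exact: cLnorm1_ge0.
have w0 := ltW (weight_gt0 xi).
have d0 : ComplexField.Normc.normc (fourier u0 xi) <=
    8 / cutoff_lim R m.+1 * fine (sobolev_norm m.+2 1 u0) * weight xi.
  rewrite (mulrAC 8) (mulrAC (8 * _)) ler_pdivlMr// mulrC.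
  exact: (fourier_decay ord0).
have d1 : ComplexField.Normc.normc (fourier u1 xi) <=
    8 / cutoff_lim R m.+1 * fine (sobolev_norm m.+2 1 u1) * weight xi.
  rewrite (mulrAC 8) (mulrAC (8 * _)) ler_pdivlMr// mulrC.
  exact: (fourier_decay ord0).
rewrite /solution_hat /green_kernel.
apply: le_trans (le_normcD _ _) _; rewrite !ComplexField.Normc.normcM.
have := normc_ge0 (green_hat ord0 xi t).
have := normc_ge0 (cderive1 (green_hat ord0 xi) t + (normsq xi)%:C * green_hat ord0 xi t).
move: (ComplexField.Normc.normc (_ + _)) (ComplexField.Normc.normc (green_hat _ _ _)).
move: (ComplexField.Normc.normc _) d0 (ComplexField.Normc.normc _) d1.
move: (fine _) W0 (fine _) W1 (weight xi) w0 => A A0 B B0 w w0 f fA g gB M G M0 G0.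
have K0 : 0 <= 8 / cutoff_lim R m.+1 by rewrite divr_ge0// ltW.
move: (8 / _) K0 fA gB => K K0 fA gB.
apply: le_trans (lerD (ler_wpM2l M0 fA) (ler_wpM2l G0 gB)) _.
(* The difference consists of the cross terms of [(A + B) * (M + G)], all nonnegative. *)
rewrite -subr_ge0 (_ : _ - _ = K * w * (M * B + G * A)); last by ring.
by rewrite !mulr_ge0 ?addr_ge0 ?mulr_ge0.
Qed.

Theorem theorem4p1 (R : realType) (n : nat) (n_ge3 : (3 <= n)%N) :
  let e1 : 'I_n := Ordinal (ltnW (ltnW n_ge3)) in
  exists C : R, forall u0 u1 : 'rV[R]_n -> R[i],
    sobolev n.+1 1%E u0 -> sobolev n.+1 1%E u1 ->
    forall t : R, 0 < t ->
      (cLnorm +oo%E (solution e1 u0 u1 t) <=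
       (C * t `^ (- 2^-1))%:E *
         (sobolev_norm n.+1 1%E u0 + sobolev_norm n.+1 1%E u1))%E.
Proof.
case: n n_ge3 => // m m_ge2 e1.
have e10 : e1 = ord0 by exact: val_inj.
have [C C0 HC] := @upint_le_kernel R m m_ge2.
pose K : R := 8 / cutoff_lim R m.+1.
have K0 : 0 <= K by rewrite divr_ge0// ltW// cutoff_lim_gt0.
(* The Fourier inversion factor, 2 for real and imaginary parts, [K] from the decay of the
   transforms of the data, and [C] from the kernel integral. *)
exists ((2 * pi) ^- m.+1 * (2 * (K * C))) => u0 u1 s0 s1 t t0; rewrite {}e10.
set W0 := sobolev_norm _ _ u0; set W1 := sobolev_norm _ _ u1.
have W0E : W0 = (fine W0)%:E by rewrite fineK// sobolev_norm_fin_num.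
have W1E : W1 = (fine W1)%:E by rewrite fineK// sobolev_norm_fin_num.
have W0p : 0 <= fine W0.
  by apply: fine_ge0; apply: sume_ge0 => a _; exact: cLnorm1_ge0.
have W1p : 0 <= fine W1.
  by apply: fine_ge0; apply: sume_ge0 => a _; exact: cLnorm1_ge0.
rewrite W0E W1E -EFinD -EFinM.
have KW : 0 <= K * (fine W0 + fine W1) by rewrite mulr_ge0 ?addr_ge0.
have H : upint_le (lebesgue_rV R m.+1)
    (fun xi => ComplexField.Normc.normc (solution_hat ord0 u0 u1 t xi))
    (K * (fine W0 + fine W1) * (C / Num.sqrt t)).
  apply: upint_le_mono; last exact: upint_leZ KW (HC t t0).
  by move=> xi; exact: normc_solution_hat_le.
have -> : (2 * pi) ^- m.+1 * (2 * (K * C)) * t `^ (- 2^-1) * (fine W0 + fine W1) =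
    (2 * pi) ^- m.+1 * (2 * (K * (fine W0 + fine W1) * (C / Num.sqrt t))).
  by rewrite powRN -powR12_sqrt ?(ltW t0)//; ring.
apply: cLnorm_infty_le => [|x]; last exact: inverse_fourier_le.
apply: mulr_ge0; first by rewrite invr_ge0 exprn_ge0// mulr_ge0// pi_ge0.
by rewrite mulr_ge0// mulr_ge0// divr_ge0// sqrtr_ge0.
Qed.
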